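(* Let $\Omega\subset\mathbb{R}^d$ be closed and convex with $0\in\Omega$. Let $\bar\mu$ be a probability measure on $\Omega$ with density (with respect to Lebesgue measure on $\mathbb{R}^d$) $\bar u(x)=A[(\rho^2-|x|^2)\vee0]$, where $A,\rho>0$, and let $\bar x(0),\bar x(1)\in\Omega$ be assigned. Let $R:[0,1]\to(0,\infty)$ and $\bar x:[0,1]\to\mathbb{R}^d$ be $C^2$ functions, $\bar x$ having the assigned endpoint values, such that the measures $\mu_t=(T^t)_\sharp\bar\mu$, $T^t(x)=R(t)x+\bar x(t)$, are supported in $\Omega$, and suppose that the curve $\mu$ is parametrized so that $K=F(t)V(t)^{-1/2}$ is constant (with $V>0$). Then $\mu$ is a moving self-similar solution, i.e. its density $u$ and its tangent field $v$ solve $$\begin{cases}-2V(t)^{1/2}\nabla u+K\left(v\cdot\nabla v+\frac{d}{dt}v\right)=0&\text{in }\{u>0\},\\ \frac{d}{dt}u+\nabla\cdot(vu)=0&\text{in }\Omega,\\ u\,v\cdot n=0&\text{on }\partial\Omega,\\ \lim_{t\downarrow0}u(t,\cdot)\mathcal{L}^d=\mu_0,\qquad\lim_{t\uparrow1}u(t,\cdot)\mathcal{L}^d=\mu_1,\end{cases}$$ if and only if $\bar x(t)$ moves on the straight line segment from $\bar x(0)$ to $\bar x(1)$ with constant speed and $R$ is a strictly concave function of $t$. That is, writing $r(t)=\rho R(t)$ for the radius of the support of $\mu_t$, if and only if $$\bar x''=0,\qquad r^{2d}\left(d\,(r')^2+(d+4)|\bar x'|^2\right)\text{ is constant, and }R\text{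 is strictly concave.}$$
   Context: $\mathcal{L}^d$ is Lebesgue measure, $n$ is the outer normal to $\partial\Omega$, $a\vee b=\max\{a,b\}$, $\sharp$ is push-forward, and $v\cdot\nabla v$ is the vector whose $i$-th component is $\sum_jv_j\,\partial v_i/\partial x_j$. The tangent field of a curve $\mu$ in the quadratic Wasserstein space $W_2(\Omega)$ is the velocity field (solution $v$ of the continuity equation with $v_t\in[L^2(\mu_t)]^d$) of minimal $L^2(\mu_t)$ norm for a.e. $t$; for the curve above it is $v_t(x)=\frac{R'(t)}{R(t)}(x-\bar x(t))+\bar x'(t)$. Here $$F(t)=\int_\Omega u(t,x)^2\,dx,\qquad V(t)=\int_\Omega|v_t|^2u(t,x)\,dx.$$ The first equation is understood pointwise on the set $\{u>0\}$; the continuity equation together with the boundary condition means $\frac{d}{dt}\int\phi\,u\,dx=\int\nabla\phi\cdot v\,u\,dx$ for a.e. $t$ and all $\phi\in C^1_c(\Omega)$, not required to vanish on $\partial\Omega$; the limits are weak limits of measures. *)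

(* Defs.v *)
From HB Require Import structures.
From mathcomp Require Import all_boot all_order all_algebra.
From mathcomp Require Import all_classical all_reals all_analysis.
From mathcomp Require Import measurable_realfun.

Set Implicit Arguments.
Unset Strict Implicit.
Unset Printing Implicit Defensive.

Import Order.TTheory GRing.Theory Num.Theory.
Import numFieldNormedType.Exports.

Local Open Scope classical_set_scope.
Local Open Scope ring_scope.

(* 'rV[R]_n carries the product of the Borel sigma-algebras of its coordinates,
   which coincides with the Borel sigma-algebra of R^n. *)
Section measurable_rV.
Context {R : realType} {n : nat}.

Definition coord_rV (i : 'I_n) (x : 'rV[R]_n) : R := x 0 i.

Let rV_set0 : g_sigma_preimage coord_rV set0.
Proof. exact: sigma_algebra0. Qed.

Let rV_setC A : g_sigma_preimage coord_rV A -> g_sigma_preimage coord_rV (~` A).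
Proof. exact: sigma_algebraC. Qed.

Let rV_bigcup (F : _^nat) : (forall i, g_sigma_preimage coord_rV (F i)) ->
  g_sigma_preimage coord_rV (\bigcup_i (F i)).
Proof. exact: sigma_algebra_bigcup. Qed.

HB.instance Definition _ := @isMeasurable.Build default_measure_display
  'rV[R]_n (g_sigma_preimage coord_rV) rV_set0 rV_setC rV_bigcup.

End measurable_rV.

Lemma measurable_coord_rV (R : realType) (n : nat) (i : 'I_n) :
  measurable_fun setT (@coord_rV R n i).
Proof.
move=> _ Y mY; rewrite setTI; apply: sub_sigma_algebra => /=.
rewrite -bigcup_seq/=; exists i => /=; first by rewrite mem_index_enum.
by exists Y => //; rewrite setTI.
Qed.

Lemma measurable_fun_rV d (T : measurableType d) (R : realType) (n : nat)
    (f : T -> 'rV[R]_n) :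
  (forall i, measurable_fun setT (fun x => f x 0 i)) -> measurable_fun setT f.
Proof.
move=> mf.
suff fsub : g_sigma_preimage (fun i => coord_rV i \o f) `<=` measurable.
  move=> _ A mA; apply: fsub; rewrite g_sigma_preimage_comp.
  by exists A.
apply: smallest_sub; first exact: sigma_algebra_measurable.
case: n => [|n] in f mf *; first by rewrite big_ord0.
rewrite -bigcup_mkord_ord; apply: bigcup_sub => i Ii.
by move=> A [B mB <-]; exact: mf.
Qed.

(* Lebesgue measure on R^n *)
Section lebesgue_rV.
Context {R : realType}.

Definition cons_rV (n : nat) (p : measurableTypeR R * 'rV[R]_n) : 'rV[R]_n.+1 :=
  row_mx (p.1 : R)%:M p.2.

Definition uncons_rV (n : nat) (x : 'rV[R]_n.+1) :
    measurableTypeR R * 'rV[R]_n :=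
  (x 0 0, @rsubmx R 1 1 n x).

Lemma cons_rVl n p i (j : 'I_1) : i = lshift n j -> @cons_rV n p 0 i = p.1.
Proof. by move=> ->; rewrite [LHS](@row_mxEl R 1 1 n) mxE ord1 eqxx mulr1n. Qed.

Lemma cons_rVr n p i (j : 'I_n) : i = rshift 1 j -> @cons_rV n p 0 i = p.2 0 j.
Proof. by move=> ->; rewrite [LHS](@row_mxEr R 1 1 n). Qed.

Lemma cons_rVK n : cancel (@cons_rV n) (@uncons_rV n).
Proof.
move=> [a x]; rewrite /uncons_rV (@cons_rVl _ _ _ 0); last exact/val_inj.
by rewrite /cons_rV /= row_mxKr.
Qed.

Lemma measurable_cons_rV n : measurable_fun setT (@cons_rV n).
Proof.
apply: measurable_fun_rV => i.
have [j ij|j ij] := @fintype.splitP 1 n i.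
  rewrite (_ : (fun _ => _) = fst); first exact: measurable_fst.
  by apply/funext => p; rewrite (@cons_rVl _ _ _ j)//; exact/val_inj.
rewrite (_ : (fun _ => _) = coord_rV j \o snd).
  by apply: measurableT_comp => //; exact: measurable_coord_rV.
by apply/funext => p; rewrite (@cons_rVr _ _ _ j)//; exact/val_inj.
Qed.

Lemma measurable_uncons_rV n : measurable_fun setT (@uncons_rV n).
Proof.
apply/measurable_fun_pairP; split; first exact: (measurable_coord_rV 0).
apply: measurable_fun_rV => i.
rewrite (_ : (fun _ => _) = @coord_rV R n.+1 (rshift 1 i)).
  exact: measurable_coord_rV.
by apply/funext => x; rewrite /= mxE.
Qed.

Definition measure_cons_rV (n : nat)
    (m : {sigma_finite_measure set 'rV[R]_n -> \bar R}) :
  set 'rV[R]_n.+1 -> \bar R := pushforward (lebesgue_measure \x m)%E (@cons_rV n).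

Section measure_cons_rV.
Context (n : nat) (m : {sigma_finite_measure set 'rV[R]_n -> \bar R}).

Let pushforward_cons_rV :=
  measure_function_pushforward__canonical__measure_function_Measure
    (lebesgue_measure \x m)%E (@measurable_cons_rV n).

HB.instance Definition _ := isMeasure.Build _ _ _ (measure_cons_rV m)
  (measure0 pushforward_cons_rV) (measure_ge0 pushforward_cons_rV)
  (@measure_semi_sigma_additive _ _ _ pushforward_cons_rV).

Let measure_cons_rV_sigma_finite : sigma_finite setT (measure_cons_rV m).
Proof.
have /sigma_finiteP[F [FT ndF Foo]] := sigma_finiteT (@lebesgue_measure R).
have /sigma_finiteP[G [GT ndG Goo]] := sigma_finiteT m.
exists (fun k => @uncons_rV n @^-1` (F k `*` G k)).
  rewrite -preimage_bigcup (_ : \bigcup_k _ = setT) ?preimage_setT//.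
  rewrite -subTset => -[a x] _.
  have : [set: measurableTypeR R] a by []; rewrite FT => -[i _ Fia].
  have : [set: 'rV[R]_n] x by []; rewrite GT => -[j _ Gjx].
  exists (maxn i j) => //; split.
    by move: a Fia; apply/subsetPset/ndF/leq_maxl.
  by move: x Gjx; apply/subsetPset/ndG/leq_maxr.
move=> k; have [mF Fk] := Foo k; have [mG Gk] := Goo k.
have mFG : measurable (F k `*` G k) by exact: measurableX.
split; first by rewrite -[X in measurable X]setTI; exact: measurable_uncons_rV.
rewrite /measure_cons_rV /pushforward -comp_preimage.
rewrite (_ : _ \o _ = id) ?preimage_id; last exact/funext/cons_rVK.
by rewrite product_measure1E// lte_mul_pinfty// ge0_fin_numE.
Qed.

HB.instance Definition _ := Measure_isSigmaFinite.Build _ _ _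
  (measure_cons_rV m) measure_cons_rV_sigma_finite.

End measure_cons_rV.

(* Lebesgue measure on R^n, as the iterated product of the one-dimensional one;
   R^0 is a point of mass 1. *)
Fixpoint lebesgue_rV (n : nat) : {sigma_finite_measure set 'rV[R]_n -> \bar R} :=
  if n is n'.+1 then [the {sigma_finite_measure set _ -> \bar R} of
    measure_cons_rV (lebesgue_rV n')]
  else [the {sigma_finite_measure set _ -> \bar R} of \d_(0 : 'rV[R]_0)].

End lebesgue_rV.

(* `|x| on 'rV[R]_n is the sup norm of the library, so the Euclidean structure
   is made explicit. *)
Definition dot (R : realType) (d : nat) (x y : 'rV[R]_d) : R :=
  \sum_(i < d) x 0 i * y 0 i.

Definition sqnorm (R : realType) (d : nat) (x : 'rV[R]_d) : R := dot x x.

Definition gradient (R : realType) (d : nat) (f : 'rV[R]_d -> R)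
    (x : 'rV[R]_d) : 'rV[R]_d :=
  \row_(i < d) 'D_(delta_mx 0 i) f x.

(* (v . nabla) v *)
Definition convection (R : realType) (d : nat) (v : 'rV[R]_d -> 'rV[R]_d)
    (x : 'rV[R]_d) : 'rV[R]_d :=
  \row_(i < d) \sum_(j < d)
    v x 0 j * 'D_(delta_mx 0 j) (fun y => v y 0 i) x.

(* Derivative of a function on [0, 1]: only values on [0, 1] matter, and the
   derivative is one-sided at the endpoints. *)
Section C2_01.
Context {R : realType} {W : normedModType R}.
Implicit Types (f : R -> W) (t : R).

Definition diff_quotient f t (s : R) : W := (s - t)^-1 *: (f s - f t).

Definition derivable01 f t : Prop :=
  cvg (diff_quotient f t @ within `[0, 1] t^').

Definition derive01 f t : W :=
  lim (diff_quotient f t @ within `[0, 1] t^').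

Definition C2_01 f : Prop :=
  [/\ forall t, 0 <= t <= 1 -> derivable01 f t,
      forall t, 0 <= t <= 1 -> derivable01 (derive01 f) t
    & {within `[0, 1], continuous (derive01 (derive01 f))}].

End C2_01.

Definition strictly_concave01 (R : realType) (f : R -> R) : Prop :=
  forall s t k : R, 0 <= s <= 1 -> 0 <= t <= 1 -> s != t -> 0 < k < 1 ->
    k * f s + (1 - k) * f t < f (k * s + (1 - k) * t).

Definition affine (R : realType) (d : nat) (r : R) (c x : 'rV[R]_d) :
  'rV[R]_d := r *: x + c.

Lemma measurable_affine (R : realType) (d : nat) (r : R) (c : 'rV[R]_d) :
  measurable_fun setT (affine r c).
Proof.
apply: measurable_fun_rV => i.
rewrite (_ : (fun _ => _) = (fun x => r * coord_rV i x + c 0 i)).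
  apply: measurable_funD => //; apply: measurable_funM => //.
  exact: measurable_coord_rV.
by apply/funext => x; rewrite !mxE.
Qed.

Definition affine_push (R : realType) (d : nat)
    (m : {measure set 'rV[R]_d -> \bar R}) (r : R) (c : 'rV[R]_d) :
  set 'rV[R]_d -> \bar R := pushforward m (affine r c).

Section affine_push.
Context (R : realType) (d : nat) (m : {measure set 'rV[R]_d -> \bar R}).
Context (r : R) (c : 'rV[R]_d).

Let push :=
  measure_function_pushforward__canonical__measure_function_Measure
    m (measurable_affine r c).

HB.instance Definition _ := isMeasure.Build _ _ _ (affine_push m r c)
  (measure0 push) (measure_ge0 push) (@measure_semi_sigma_additive _ _ _ push).

End affine_push.

Definition ssim_curve (R : realType) (d : nat)
    (m : {measure set 'rV[R]_d -> \bar R}) (Rs : R -> R)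
    (xbar : R -> 'rV[R]_d) (t : R) : {measure set 'rV[R]_d -> \bar R} :=
  [the {measure set _ -> \bar R} of affine_push m (Rs t) (xbar t)].

Section profile.
Context {R : realType} {d : nat}.
Implicit Types (A rho : R) (Rs : R -> R) (xbar : R -> 'rV[R]_d).

Definition profile A rho (x : 'rV[R]_d) : R :=
  A * Num.max (rho ^+ 2 - sqnorm x) 0.

Definition ssim_density A rho Rs xbar (t : R) (x : 'rV[R]_d) : R :=
  (Rs t) ^- d * profile A rho ((Rs t)^-1 *: (x - xbar t)).

Definition ssim_velocity Rs xbar (t : R) (x : 'rV[R]_d) : 'rV[R]_d :=
  (derive01 Rs t / Rs t) *: (x - xbar t) + derive01 xbar t.

End profile.

Section equations.
Context {R : realType} {d : nat}.
Implicit Types (Omega : set 'rV[R]_d) (phi : 'rV[R]_d -> R).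
Implicit Types (m : R -> {measure set 'rV[R]_d -> \bar R}).
Implicit Types (u : R -> 'rV[R]_d -> R) (v : R -> 'rV[R]_d -> 'rV[R]_d).

Definition has_density (mu : {measure set 'rV[R]_d -> \bar R})
    (f : 'rV[R]_d -> R) : Prop :=
  [/\ measurable_fun setT f, forall x, 0 <= f x &
      forall B, measurable B -> mu B = (\int[lebesgue_rV d]_(x in B) (f x)%:E)%E].

(* Elements of C^1_c(Omega), for closed Omega, are the restrictions to Omega of
   such functions; they need not vanish on the boundary of Omega. *)
Definition C1c phi : Prop :=
  [/\ forall x, differentiable phi x, continuous (gradient phi)
    & compact (closure [set x | phi x != 0])].

(* v solves the continuity equation for the curve m, with v_t in L^2(m_t) *)
Definition velocity_field Omega m v : Prop :=
  {ae lebesgue_measure, forall t : R, 0 < t < 1 ->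
    [/\ measurable_fun Omega (v t),
        (\int[m t]_(x in Omega) (sqnorm (v t x))%:E < +oo)%E &
        forall phi, C1c phi ->
          is_derive t 1 (fun s => \int[m s]_(x in Omega) phi x)
            (\int[m t]_(x in Omega) dot (gradient phi x) (v t x))]}.

Definition tangent_field Omega m v : Prop :=
  velocity_field Omega m v /\
  forall w, velocity_field Omega m w ->
    {ae lebesgue_measure, forall t : R, 0 < t < 1 ->
      (\int[m t]_(x in Omega) (sqnorm (v t x))%:E <=
       \int[m t]_(x in Omega) (sqnorm (w t x))%:E)%E}.

Definition Ffun Omega u (t : R) : R :=
  \int[lebesgue_rV d]_(x in Omega) (u t x ^+ 2).

Definition Vfun Omega u v (t : R) : R :=
  \int[lebesgue_rV d]_(x in Omega) (sqnorm (v t x) * u t x).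

Definition momentum_equation Omega K u v : Prop :=
  forall (t : R) (x : 'rV[R]_d), 0 < t < 1 -> 0 < u t x ->
    [/\ differentiable (u t) x, differentiable (v t) x,
        derivable (fun s => v s x) t 1 &
        - (2 * Num.sqrt (Vfun Omega u v t)) *: gradient (u t) x
          + K *: (convection (v t) x + 'D_1 (fun s => v s x) t) = 0].

(* weak form of u_t + div (v u) = 0 in Omega, u v . n = 0 on the boundary *)
Definition continuity_equation Omega u v : Prop :=
  {ae lebesgue_measure, forall t : R, 0 < t < 1 ->
    forall phi, C1c phi ->
      is_derive t 1
        (fun s => \int[lebesgue_rV d]_(x in Omega) (phi x * u s x))
        (\int[lebesgue_rV d]_(x in Omega)
           (dot (gradient phi x) (v t x) * u t x))}.

Definition weak_limit Omega u (G : set_system R)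
    (mu : {measure set 'rV[R]_d -> \bar R}) : Prop :=
  forall f : 'rV[R]_d -> R, continuous f -> (exists M, forall x, `|f x| <= M) ->
    (fun t => \int[lebesgue_rV d]_(x in Omega) (f x * u t x)) @ G -->
      \int[mu]_(x in Omega) f x.

Definition solves_system Omega K m u v : Prop :=
  [/\ momentum_equation Omega K u v,
      continuity_equation Omega u v,
      weak_limit Omega u 0^'+ (m 0) &
      weak_limit Omega u 1^'- (m 1)].

End equations.

(* Main.v *)
Require Import Defs.
From mathcomp Require Import all_boot all_order all_algebra.
From mathcomp Require Import all_classical all_reals all_analysis.
From mathcomp Require Import measurable_realfun ring lra.

Set Implicit Arguments.
Unset Strict Implicit.
Unset Printing Implicit Defensive.

Import Order.TTheory GRing.Theory Num.Theory.
Import numFieldNormedType.Exports.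

Local Open Scope classical_set_scope.
Local Open Scope ring_scope.

(** Everything is computed by pulling integrals against [mu_t] back to the
    profile measure [m] along [T^t x = Rs t *: x + xbar t].

    In these coordinates the velocity is [Rs' x + xbar'], and [m] is centred
    ([mean_dot]), so [F = Rs ^- d * F0] and [V = M2 * Rs' ^+ 2 + |xbar'|^2], with
    [F0] the energy and [M2] the second moment of the profile.  Hence
    [F / sqrt V = K] is the conservation law
    [Rs ^+ (2 d) * (M2 * Rs' ^+ 2 + |xbar'|^2) = F0 ^+ 2 / K ^+ 2]
    ([ssim_conserved_energy]).  Two relations determine the moments: the mass
    of the profile is 1, which gives [F0 = A (rho^2 - M2)], and the virial
    identity [d * F0 = 4 A * M2] ([virial]).  Therefore [M2 = d rho^2 / (d + 4)],
    which turns the conservation law into the constancy of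
    [r^(2d) (d r'^2 + (d + 4) |xbar'|^2)].

    On [{u > 0}] one has [nabla u = - 2 A Rs^(-d-2) (x - xbar)] and
    [v . nabla v + dv/dt = (Rs'' / Rs) (x - xbar) + xbar''].  The momentum
    equation is thus affine in [x - xbar], and holds on a ball if and only if
    [xbar'' = 0] and [K^2 Rs'' Rs^(2d+1) = - 4 A F0] ([ssim_momentumP]).  The
    right-hand side being negative, this gives strict concavity.  Conversely,
    if [xbar'] is constant, differentiating the conservation law gives
    [Rs' (M2 Rs'' Rs^(2d+1) + d F0^2 / K^2) = 0]; a strictly concave [Rs] is
    constant on no interval, so by continuity of [Rs''] the second factor
    vanishes identically ([acceleration_of_conserved_energy]), and the virial
    identity says that this is the equation required of [Rs''].

    The other equations hold for every self-similar curve.  The continuity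
    equation is differentiation under the integral sign
    ([is_derive_Rintegral_curve]), and the weak limits are continuity under the
    integral sign ([ssim_weak_limit]).  The field [v_t] is tangent because on
    the support of [mu_t] it is the gradient of a quadratic potential, which
    can be cut off to a test function ([potential]): tested against it, the
    continuity equation of a competitor [w] says that [w - v] is orthogonal
    to [v] in [L^2(mu_t)] ([ssim_velocity_minimal]). *)

(** * Borel sets of R^n *)

Section borel_rV.
Context {R : realType} {n : nat}.
Implicit Types U : set 'rV[R]_n.

(** Boxes with rational centre and rational half-width form a countable basis of
    the topology, and are measurable one coordinate at a time. *)
Definition rat_box (p : 'rV[rat]_n * rat) : set 'rV[R]_n :=
  [set x | forall i, `|x 0 i - ratr (p.1 0 i)| < ratr p.2].

Lemma measurable_rat_box p : measurable (rat_box p).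
Proof.
rewrite (_ : rat_box p = \bigcap_(i in [set: 'I_n])
    [set x : 'rV[R]_n | `|coord_rV i x - ratr (p.1 0 i)| < ratr p.2]); last first.
  by apply/seteqP; split=> x /= Hx i; [move=> _|]; exact: Hx.
apply: fin_bigcap_measurable => // i _.
have m : measurable_fun setT
    (fun x : 'rV[R]_n => `|coord_rV i x - ratr (p.1 0 i)| < ratr p.2).
  apply: measurable_fun_ltr => //; apply: measurableT_comp => //.
  by apply: measurable_funB => //; exact: measurable_coord_rV.
by rewrite -[X in measurable X]setTI; exact: m.
Qed.

Lemma rat_box_nbhs U x : open U -> U x ->
  exists2 p, rat_box p `<=` U & rat_box p x.
Proof.
move=> oU Ux.
have /nbhs_ballP[e /= e0 xeU] : nbhs x U by exact: open_nbhs_nbhs.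
have e20 : 0 < e / 2 by rewrite divr_gt0.
have [r] := rat_in_itvoo e20; rewrite in_itv /= => /andP[r0 re].
have /choice[q hq] : forall i, exists q : rat, `|x 0 i - ratr q| < ratr r.
  move=> i; have : x 0 i - ratr r < x 0 i + ratr r by lra.
  move=> /rat_in_itvoo[q]; rewrite in_itv/= => /andP[q1 q2].
  by exists q; rewrite ltr_norml; apply/andP; split; lra.
exists (\row_i q i, r) => /= [y /= yp|i]; last by rewrite mxE.
apply: xeU; split => // i j; rewrite ord1 /ball/=.
rewrite (_ : x 0 j - y 0 j = (x 0 j - ratr (q j)) - (y 0 j - ratr (q j))); last first.
  by rewrite opprB addrA subrK.
have := yp j; rewrite mxE => yj; have := hq j => xj.
rewrite (le_lt_trans (ler_normB _ _))//; lra.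
Qed.

Lemma open_measurable_rV U : open U -> measurable U.
Proof.
move=> oU; rewrite (_ : U = \bigcup_p (if `[< rat_box p `<=` U >] then rat_box p else set0)).
  apply: countable_bigcupT_measurable; first exact: countableP.
  by move=> p; case: ifPn => // _; exact: measurable_rat_box.
apply/seteqP; split=> x.
  by move=> /(rat_box_nbhs oU)[p pU px]; exists p => //; rewrite asboolT.
by move=> [p _]; case: ifPn => // /asboolP; exact.
Qed.

Lemma closed_measurable_rV U : closed U -> measurable U.
Proof.
by move=> cU; rewrite -[U]setCK; apply: measurableC;
  apply: open_measurable_rV; exact: closed_openC.
Qed.

Lemma continuous_measurable_rV (f : 'rV[R]_n -> R) :
  continuous f -> measurable_fun setT f.
Proof.
move=> /continuousP cf; apply: (measurability _ (RGenOpens.measurableE R)).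
move=> _ [_ [a [b ->]] <-]; rewrite setTI.
by apply: open_measurable_rV; exact/cf/interval_open.
Qed.

End borel_rV.

(** * Integration against a density *)

Section integral_density.
Local Open Scope ereal_scope.
Context d (T : measurableType d) (R : realType).
Variables (nu mu : {measure set T -> \bar R}) (h : T -> R).
Hypothesis mh : measurable_fun setT h.
Hypothesis h0 : forall x, (0 <= h x)%R.
Hypothesis nuE : forall B, measurable B -> nu B = \int[mu]_(x in B) (h x)%:E.

Import HBNNSimple.

Lemma ge0_integral_density D (f : T -> \bar R) : measurable D ->
  measurable_fun D f -> (forall x, 0 <= f x) ->
  \int[nu]_(x in D) f x = \int[mu]_(x in D) (f x * (h x)%:E).
Proof.
move=> mD mf f0.
have mhD : measurable_fun D (EFin \o h) by exact/measurable_EFinP/measurable_funTS.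
pose g := nnsfun_approx mD mf.
transitivity (limn (fun n => \int[nu]_(x in D) (g n x)%:E)).
  rewrite -monotone_convergence//.
  - apply: eq_integral => x /[!inE] xD; apply/esym/cvg_lim => //.
    by apply: cvg_nnsfun_approx.
  - by move=> n; exact/measurable_EFinP/measurable_funTS.
  - by move=> n y _; rewrite lee_fin.
  - by move=> y _ m n mn; rewrite lee_fin; exact/lefP/nd_nnsfun_approx.
transitivity (limn (fun n => \int[mu]_(x in D) ((g n x)%:E * (h x)%:E))); last first.
  rewrite -monotone_convergence//.
  - apply: eq_integral => x /[!inE] xD; apply/cvg_lim => //.
    by apply: cvgeZr => //; exact: cvg_nnsfun_approx.
  - move=> n; apply: emeasurable_funM => //.
    exact/measurable_EFinP/measurable_funTS.
  - by move=> n y _; rewrite mule_ge0// lee_fin.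
  - move=> y _ m n mn; rewrite lee_wpmul2r ?lee_fin//.
    exact/lefP/nd_nnsfun_approx.
congr (limn _); apply/funext => n.
transitivity (\sum_(k \in range (g n)) \int[nu]_(x in D)
    (k * \1_(g n @^-1` [set k]) x)%:E).
  rewrite -ge0_integral_fsum//.
  - by apply: eq_integral => x _; rewrite fsumEFin// -fimfunE.
  - by move=> r; exact/measurable_EFinP/measurable_funM.
  - by move=> r x _; rewrite nnfun_muleindic_ge0.
transitivity (\sum_(k \in range (g n)) \int[mu]_(x in D)
    ((k * \1_(g n @^-1` [set k]) x)%:E * (h x)%:E)); last first.
  rewrite -ge0_integral_fsum//.
  - apply: eq_integral => x _.
    rewrite -ge0_mule_fsuml => [|y]; last exact: nnfun_muleindic_ge0.
    by rewrite fsumEFin// -fimfunE.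
  - move=> r; apply: emeasurable_funM => //.
    exact/measurable_EFinP/measurable_funM.
  - by move=> r x _; apply: mule_ge0; [exact: nnfun_muleindic_ge0|rewrite lee_fin].
apply: eq_fsbigr => r /[!inE] -[y _ ry].
have r0 : (0 <= r)%R by rewrite -ry.
rewrite integralZl_indic_nnsfun// integral_indic//.
under [RHS]eq_integral do rewrite EFinM -muleA.
rewrite [RHS]ge0_integralZl ?lee_fin//.
- congr (_ * _); rewrite nuE//; last exact: measurableI.
  rewrite setIC [LHS]integral_mkcondr; apply: eq_integral => x _.
  by rewrite epatch_indic muleC.
- by apply: emeasurable_funM => //; exact/measurable_EFinP.
- by move=> x _; rewrite mule_ge0// lee_fin.
Qed.

(** Both sides are differences of the integrals of the positive and negative
    parts, and multiplication by [h >= 0] commutes with taking these parts. *)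
Lemma integral_density D (f : T -> R) : measurable D -> measurable_fun D f ->
  \int[nu]_(x in D) (f x)%:E = \int[mu]_(x in D) (f x * h x)%:E.
Proof.
move=> mD mf; rewrite [LHS]integralE [RHS]integralE; congr (_ - _).
- rewrite ge0_integral_density//; last exact/measurable_funepos/measurable_EFinP.
  apply: eq_integral => x _; rewrite !funeposE.
  by rewrite EFinM maxe_pMl ?mul0e ?lee_fin//.
- rewrite ge0_integral_density//; last exact/measurable_funeneg/measurable_EFinP.
  apply: eq_integral => x _; rewrite !funenegE.
  by rewrite EFinM -mulNe maxe_pMl ?mul0e ?lee_fin//.
Qed.

End integral_density.

(** * Lebesgue measure under dilations and translations *)

Section lebesgue_affine.
Local Open Scope ereal_scope.
Context {R : realType}.

(** The push-forward of Lebesgue measure by [x |-> r x + c], scaled by [|r|],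
    agrees with Lebesgue measure on half-open intervals. *)
Lemma ge0_lebesgue_affine (r c : R) (f : R -> \bar R) : (r != 0)%R ->
  measurable_fun [set: measurableTypeR R] f -> (forall x, 0 <= f x) ->
  \int[lebesgue_measure]_x f x =
  `|r|%R%:E * \int[lebesgue_measure]_x f (r * x + c)%R.
Proof.
move=> r0 mf f0.
pose T : measurableTypeR R -> measurableTypeR R := fun x => (r * x + c)%R.
have mT : measurable_fun setT T.
  by apply: measurable_funD => //; exact: measurable_funM.
pose push := measure_function_pushforward__canonical__measure_function_Measure
  (@lebesgue_measure R) mT.
have nr0 : (0 <= `|r|)%R by [].
pose m := mscale (NngNum nr0) push.
rewrite (@eq_measure_integral _ _ _ _ m); last first.
  move=> A mA _; apply: (@lebesgue_measure_unique R m) => //.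
  move=> _ [[a b] _ <-] /=; rewrite /m /mscale /= /pushforward.
  have [r_gt0|r_le0] := ltP 0%R r.
    rewrite (_ : T @^-1` _ = `](a - c) / r, (b - c) / r]%classic)%R; last first.
      apply/seteqP; split=> x /=; rewrite !in_itv/= /T ltr_pdivrMr// ler_pdivlMr//;
      by move=> /andP[? ?]; apply/andP; split; lra.
    rewrite !lebesgue_measure_itv/= !lte_fin ltr_pM2r ?invr_gt0// ltrD2r.
    case: ifPn => _; rewrite ?mule0// -!EFinB -EFinM; congr EFin.
    by rewrite gtr0_norm//; field.
  have r_lt0 : (r < 0)%R by rewrite lt_neqAle r0.
  rewrite (_ : T @^-1` _ = `[(b - c) / r, (a - c) / r[%classic)%R; last first.
    apply/seteqP; split=> x /=; rewrite !in_itv/= /T ltr_ndivlMr// ler_ndivrMr//;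
    by move=> /andP[? ?]; apply/andP; split; lra.
  rewrite !lebesgue_measure_itv/= !lte_fin ltr_nM2r ?invr_lt0// ltrD2r.
  case: ifPn => _; rewrite ?mule0// -!EFinB -EFinM; congr EFin.
  by rewrite ltr0_norm//; field.
rewrite /m ge0_integral_mscale//; congr (_ * _).
by rewrite /push/= ge0_integral_pushforward.
Qed.

Lemma affine_cons_rV n (r : R) (c : 'rV[R]_n.+1) p :
  affine r c (cons_rV p) =
  cons_rV ((r * p.1 + c 0%R 0%R)%R, affine r (@rsubmx R 1 1 n c) p.2).
Proof.
apply/rowP => i; rewrite [LHS]mxE [X in (X + _)%R]mxE.
have [j ij|j ij] := @fintype.splitP 1 n i.
  have ij' : i = lshift n j by exact/val_inj.
  rewrite !(cons_rVl _ ij')/=; congr (_ + c _ _)%R.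
  by rewrite ij'; apply/val_inj; rewrite /= ord1.
have ij' : i = rshift 1 j by exact/val_inj.
by rewrite !(cons_rVr _ ij')/= !mxE ij'.
Qed.

(** Change of variables, one coordinate at a time: Lebesgue measure on [R^(n+1)]
    is the product of the line with [R^n], and an affine dilation acts
    separately on the two factors. *)
Lemma ge0_lebesgue_rV_affine n (r : R) (c : 'rV[R]_n) (f : 'rV[R]_n -> \bar R) :
  (r != 0)%R -> measurable_fun setT f -> (forall x, 0 <= f x) ->
  \int[lebesgue_rV n]_x f x =
  (`|r| ^+ n)%R%:E * \int[lebesgue_rV n]_x f (affine r c x).
Proof.
move=> r0.
elim: n => [|n IH] in c f *.
  move=> mf f0; rewrite expr0 mul1e /= !integral_dirac//; last first.
    exact: measurableT_comp (measurable_affine _ _).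
  by rewrite !diracT !mul1e (thinmx0 (affine r c 0)).
move=> mf f0.
have fcons (g : 'rV[R]_n.+1 -> \bar R) : measurable_fun setT g ->
    (forall x, 0 <= g x) -> \int[lebesgue_rV n.+1]_x g x =
    \int[lebesgue_measure]_a \int[lebesgue_rV n]_y g (cons_rV (a, y)).
  move=> mg g0.
  rewrite [LHS](@ge0_integral_pushforward _ _ _ _ _ _ (@measurable_cons_rV R n)
    (lebesgue_measure \x lebesgue_rV n) setT g)//.
  rewrite fubini_tonelli1//; last by move=> p; exact: g0.
  exact: measurableT_comp (@measurable_cons_rV R n).
have mfc : measurable_fun setT (fun p => f (@cons_rV R n p)).
  exact: measurableT_comp (@measurable_cons_rV R n).
have mfa : measurable_fun setT (f \o affine r c).
  exact: measurableT_comp (measurable_affine _ _).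
rewrite fcons// [in RHS](fcons (f \o affine r c))//.
rewrite (@ge0_lebesgue_affine r (c 0%R 0%R))//; last 2 first.
  exact: (@measurable_fun_fubini_tonelli_F _ _ _ _ _ (lebesgue_rV n) _ mfc).
  by move=> a; exact: integral_ge0.
rewrite exprS EFinM -muleA; congr (_ * _).
under eq_integral => a _.
  rewrite (IH (@rsubmx R 1 1 n c) (fun y => f (cons_rV ((r * a + c 0 0)%R, y))))//.
  under eq_integral => y _ do rewrite -(affine_cons_rV r c (a, y)).
  over.
  by apply: (measurable_fun_pair2 _ mfc).
rewrite ge0_integralZl ?lee_fin ?exprn_ge0//.
- apply: (@measurable_fun_fubini_tonelli_F _ _ _ _ _ (lebesgue_rV n)
    (fun p => f (affine r c (cons_rV p)))).
    exact: (measurableT_comp mfa (@measurable_cons_rV R n)).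
  by move=> p; exact: f0.
- by move=> a _; exact: integral_ge0.
- by move=> x; exact: f0.
Qed.

End lebesgue_affine.

(** * Euclidean structure and affine push-forward *)

Section dot.
Context {R : realType} {d : nat}.
Implicit Types x y z : 'rV[R]_d.

Lemma dotC x y : dot x y = dot y x.
Proof. by apply: eq_bigr => i _; rewrite mulrC. Qed.

Lemma dotDl x y z : dot (x + y) z = dot x z + dot y z.
Proof. by rewrite -big_split; apply: eq_bigr => i _; rewrite mxE mulrDl. Qed.

Lemma dotZl a x y : dot (a *: x) y = a * dot x y.
Proof. by rewrite mulr_sumr; apply: eq_bigr => i _; rewrite mxE mulrA. Qed.

Lemma dotDr x y z : dot x (y + z) = dot x y + dot x z.
Proof. by rewrite dotC dotDl !(dotC x). Qed.

Lemma dotZr a x y : dot x (a *: y) = a * dot x y.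
Proof. by rewrite dotC dotZl (dotC x). Qed.

Lemma sqnorm_ge0 x : 0 <= sqnorm x.
Proof. by apply: sumr_ge0 => i _; rewrite -expr2 sqr_ge0. Qed.

Lemma sqnormZ a x : sqnorm (a *: x) = a ^+ 2 * sqnorm x.
Proof. by rewrite /sqnorm dotZl dotZr mulrA. Qed.

Lemma sqnormD x y : sqnorm (x + y) = sqnorm x + 2 * dot x y + sqnorm y.
Proof. rewrite /sqnorm !dotDl !dotDr (dotC y x); ring. Qed.

Lemma measurable_fun_dot d' (T : measurableType d') D (f g : T -> 'rV[R]_d) :
  measurable_fun D f -> measurable_fun D g ->
  measurable_fun D (fun t => dot (f t) (g t)).
Proof.
move=> mf mg; rewrite /dot; apply: measurable_sum => i.
apply: measurable_funM.
  exact: (measurableT_comp (measurable_coord_rV i) mf).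
exact: (measurableT_comp (measurable_coord_rV i) mg).
Qed.

Lemma measurable_fun_sqnorm d' (T : measurableType d') D (f : T -> 'rV[R]_d) :
  measurable_fun D f -> measurable_fun D (fun t => sqnorm (f t)).
Proof. by move=> mf; exact: measurable_fun_dot. Qed.

Lemma ler_coord_sqnorm x i : x 0 i ^+ 2 <= sqnorm x.
Proof.
rewrite /sqnorm /dot (bigD1 i)//= -expr2 lerDl.
by apply: sumr_ge0 => j _; rewrite -expr2 sqr_ge0.
Qed.

Lemma ler_coord_norm x i : `|x 0 i| <= `|x|.
Proof.
rewrite [leRHS]/Num.Def.normr/= mx_normrE.
exact: (le_bigmax _ (fun ij : 'I_1 * 'I_d => `|x ij.1 ij.2|) (0, i)).
Qed.

End dot.

Lemma measurable_comp_affine (R : realType) (d : nat) (f : 'rV[R]_d -> R) r c :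
  measurable_fun setT f -> measurable_fun setT (f \o affine r c).
Proof. by move=> mf; exact: measurableT_comp (measurable_affine _ _). Qed.

Section affine.
Context {R : realType} {d : nat}.
Variables (m : {measure set 'rV[R]_d -> \bar R}) (r : R) (c : 'rV[R]_d).

Lemma affineK : r != 0 -> cancel (affine r c) (fun y => r^-1 *: (y - c)).
Proof. by move=> r0 x; rewrite /affine addrK scalerA mulVf// scale1r. Qed.

Lemma has_density_affine f : 0 < r -> has_density m f ->
  has_density (affine_push m r c) (fun x => r ^- d * f (r^-1 *: (x - c))).
Proof.
move=> r0 [mf f0 mE].
have r_neq0 : r != 0 by rewrite gt_eqF.
have rd0 : 0 < r ^- d by rewrite invr_gt0 exprn_gt0.
have mg : measurable_fun setT (fun x : 'rV[R]_d => r ^- d * f (r^-1 *: (x - c))).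
  apply: measurable_funM => //; apply: measurableT_comp => //.
  rewrite (_ : (fun _ => _) = affine r^-1 (- (r^-1 *: c))).
    exact: measurable_affine.
  by apply/funext => x; rewrite scalerBr.
split => // [x|B mB]; first by rewrite mulr_ge0// ltW.
rewrite [LHS](mE (affine r c @^-1` B)); last first.
  by rewrite -[X in measurable X]setTI; exact: measurable_affine.
rewrite [LHS]integral_mkcond [RHS]integral_mkcond.
have mgB : measurable_fun setT
    ((fun x : 'rV[R]_d => (r ^- d * f (r^-1 *: (x - c)))%:E) \_ B).
  apply: (measurable_restrictT _ mB).1; apply: measurable_funTS.
  exact/measurable_EFinP.
set g := (X in _ = (\int[_]_x X x)%E).
rewrite (@ge0_lebesgue_rV_affine _ _ r c g)//; last first.
  by apply: erestrict_ge0 => x _; rewrite lee_fin mulr_ge0// ltW.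
rewrite -ge0_integralZl//; last 2 first.
- exact: (measurableT_comp mgB (measurable_affine _ _)).
- by move=> x _; apply: erestrict_ge0 => y _; rewrite lee_fin mulr_ge0// ltW.
apply: eq_integral => x _; rewrite /g !patchE /= -[x \in _]/(affine r c x \in B).
case: ifPn => _; last by rewrite mule0.
by rewrite affineK// -EFinM mulrA gtr0_norm// divff ?mul1r// expf_neq0.
Qed.

(** The push-forward does not charge the complement of [D], so the integral over
    [D] is the integral over the whole space. *)
Lemma integral_affine_push D f : measurable D -> measurable_fun setT f ->
  affine_push m r c (~` D) = 0%E ->
  (\int[affine_push m r c]_(x in D) (f x)%:E =
   \int[m]_x (f (affine r c x))%:E)%E.
Proof.
move=> mD mf D0.
have mTD : measurable (affine r c @^-1` D).
  by rewrite -[X in measurable X]setTI; exact: measurable_affine.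
have ge0 (g : 'rV[R]_d -> \bar R) : measurable_fun setT g ->
    (forall x, (0 <= g x)%E) ->
    (\int[affine_push m r c]_(x in D) g x = \int[m]_x g (affine r c x))%E.
  move=> mg g0; rewrite /affine_push ge0_integral_pushforward//; last 2 first.
    exact: measurable_affine.
    exact: measurable_funTS.
  have mgT : measurable_fun setT (g \o affine r c).
    exact: measurableT_comp (measurable_affine _ _).
  rewrite [RHS](@ge0_negligible_integral _ _ _ _ _ (~` (affine r c @^-1` D)))//.
  - by rewrite setTD setCK.
  - exact: measurableC.
rewrite [LHS]integralE [RHS]integralE; congr (_ - _)%E.
- rewrite ge0//; first by apply: eq_integral => x _; rewrite !funeposE.
  exact/measurable_funepos/measurable_EFinP.
- rewrite ge0//; first by apply: eq_integral => x _; rewrite !funenegE.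
  exact/measurable_funeneg/measurable_EFinP.
Qed.

End affine.

(** * Moments of the paraboloid profile *)

Section profile_measure.
Context {R : realType} {d : nat} {A rho : R}.
Hypothesis hrho : 0 < rho.
Variable m : probability 'rV[R]_d R.
Hypothesis hm : has_density m (profile A rho).

Let B : set 'rV[R]_d := [set x | sqnorm x < rho ^+ 2].

Lemma measurable_sqnorm_ball : measurable B.
Proof.
have mB : measurable_fun setT (fun x : 'rV[R]_d => sqnorm x < rho ^+ 2).
  by apply: measurable_fun_ltr => //; exact: measurable_fun_sqnorm.
by rewrite -[X in measurable X]setTI; exact: mB.
Qed.
Let mB := measurable_sqnorm_ball.

(** The profile vanishes outside the open ball of radius [rho].  Functions
    therefore need to be bounded, or to agree, only on that ball: this
    replaces compactness of the support in all that follows. *)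
Lemma profile_measure_ballC : m (~` B) = 0%E.
Proof.
case: hm => _ _ ->; last exact: measurableC.
apply: integral0_eq => x /= /negP; rewrite -leNgt => xB.
by rewrite /profile (max_idPr _) ?mulr0// subr_le0.
Qed.

Lemma integrable_on_ball (f : 'rV[R]_d -> R) (M : R) : measurable_fun setT f ->
  (forall x, sqnorm x < rho ^+ 2 -> `|f x| <= M) ->
  m.-integrable setT (EFin \o f).
Proof.
move=> mf fM; apply/integrableP; split; first exact/measurable_EFinP.
rewrite (@ge0_negligible_integral _ _ _ _ _ (~` B))//; last 3 first.
- exact: measurableC.
- by apply: measurableT_comp => //; exact/measurable_EFinP.
- exact: profile_measure_ballC.
rewrite setTD setCK; apply: (@le_lt_trans _ _ (\int[m]_(x in B) (cst M%:E) x)%E).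
  apply: ge0_le_integral => //.
  by apply: measurableT_comp => //; apply/measurable_funTS; exact/measurable_EFinP.
rewrite [ltLHS](integral_cst m mB).
have mBfin : m B \is a fin_num by exact: fin_num_measure.
have -> : (M%:E * m B = (M * fine (m B))%:E)%E by rewrite EFinM fineK.
exact: ltry.
Qed.

Lemma eq_integral_ball (f g : 'rV[R]_d -> R) :
  measurable_fun setT f -> measurable_fun setT g ->
  (forall x, sqnorm x < rho ^+ 2 -> f x = g x) ->
  (\int[m]_x (f x)%:E = \int[m]_x (g x)%:E)%E.
Proof.
move=> mf mg fg; apply: ae_eq_integral => //; do 1?exact/measurable_EFinP.
exists (~` B); split; first exact: measurableC.
- exact: profile_measure_ballC.
- by move=> x /=; apply: contra_not => xB _; rewrite fg.
Qed.

(** The profile is even, and so is Lebesgue measure. *)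
Lemma integral_profile_measureN (f : 'rV[R]_d -> R) : measurable_fun setT f ->
  (\int[m]_x (f (- x))%:E = \int[m]_x (f x)%:E)%E.
Proof.
move=> mf; case: hm => mp p0 mE.
have mN : measurable_fun setT (fun x : 'rV[R]_d => - x).
  rewrite (_ : (fun x => _) = affine (-1) 0); first exact: measurable_affine.
  by apply/funext => x; rewrite /affine scaleN1r addr0.
have ge0 (g : 'rV[R]_d -> \bar R) : measurable_fun setT g ->
    (forall x, (0 <= g x)%E) -> (\int[m]_x g (- x)%R = \int[m]_x g x)%E.
  move=> mg g0; rewrite !(ge0_integral_density mp p0 mE)//; last first.
    exact: measurableT_comp mN.
  rewrite [RHS](@ge0_lebesgue_rV_affine _ _ (-1) 0)//; last 2 first.
  - by apply: emeasurable_funM => //; exact/measurable_EFinP.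
  - by move=> x; rewrite mule_ge0// lee_fin.
  rewrite normrN1 expr1n mul1e; apply: eq_integral => x _.
  by rewrite /affine scaleN1r addr0 /profile /sqnorm /dot;
    under [in RHS]eq_bigr do rewrite mxE mulrNN.
rewrite [LHS]integralE [RHS]integralE; congr (_ - _)%E.
- rewrite -[RHS]ge0//; first by apply: eq_integral => x _; rewrite !funeposE.
  exact/measurable_funepos/measurable_EFinP.
- rewrite -[RHS]ge0//; first by apply: eq_integral => x _; rewrite !funenegE.
  exact/measurable_funeneg/measurable_EFinP.
Qed.

Lemma ball_coord (x : 'rV[R]_d) i : sqnorm x < rho ^+ 2 -> `|x 0 i| <= rho.
Proof.
move=> xB; rewrite -(@ler_pXn2r _ 2) ?nnegrE ?(ltW hrho)//.
by rewrite real_normK ?num_real// (le_trans (ler_coord_sqnorm x i))// ltW.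
Qed.

Lemma normr_dot_ball (x c : 'rV[R]_d) : sqnorm x < rho ^+ 2 ->
  `|dot x c| <= \sum_(i < d) rho * `|c 0 i|.
Proof.
move=> xB; apply: le_trans (ler_norm_sum _ _ _) _.
by apply: ler_sum => i _; rewrite normrM ler_wpM2r// ball_coord.
Qed.

Lemma integrable_dot c : m.-integrable setT (fun x => (dot x c)%:E).
Proof.
apply: (@integrable_on_ball (fun x => dot x c)); last first.
  by move=> x /normr_dot_ball; exact.
exact: measurable_fun_dot.
Qed.

Lemma mean_dot c : \int[m]_x (dot x c) = 0.
Proof.
have mc : measurable_fun setT (fun x : 'rV[R]_d => dot x c).
  exact: measurable_fun_dot.
have /(congr1 fine) := integral_profile_measureN mc.
rewrite -[RHS]/(\int[m]_x (dot x c)).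
rewrite (eq_integral (fun x : 'rV[R]_d => ((-1) * dot x c)%:E)).
  by rewrite [LHS]RintegralZl//; [lra|exact: integrable_dot].
by move=> x _; rewrite -scaleN1r dotZl.
Qed.

End profile_measure.

Section moments.
Context {R : realType} {d : nat} {A rho : R}.
Hypothesis hA : 0 < A.
Variable m : probability 'rV[R]_d R.
Hypothesis hm : has_density m (profile A rho).

Definition second_moment : R := \int[m]_x sqnorm x.

Let k (x : 'rV[R]_d) : R := Num.max (rho ^+ 2 - sqnorm x) 0.

Let mk : measurable_fun setT k.
Proof.
apply: measurable_maxr => //; apply: measurable_funB => //.
exact: measurable_fun_sqnorm.
Qed.

Let msq : measurable_fun setT (@sqnorm R d).
Proof. exact: measurable_fun_sqnorm. Qed.

Let k0 x : 0 <= k x. Proof. by rewrite le_max lexx orbT. Qed.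

Lemma integrable_sqnorm : m.-integrable setT (fun x => (sqnorm x)%:E).
Proof.
apply: (integrable_on_ball hm (M := rho ^+ 2)) => // x xB.
by rewrite ger0_norm ?sqnorm_ge0// ltW.
Qed.

Let intk : m.-integrable setT (fun x => (k x)%:E).
Proof.
apply: (integrable_on_ball hm (M := rho ^+ 2)) => // x xB.
by rewrite ger0_norm// ge_max sqr_ge0 andbT lerBlDr lerDl sqnorm_ge0.
Qed.

Let Fk := \int[m]_x k x.

Let dilation_ineq (s : R) : 0 < s ->
  Fk + 2 * second_moment <= s ^+ d * Fk + 2 * s ^- 2 * second_moment.
Proof.
move=> s0; have [mp p0 mE] := hm.
have FkE : (Fk%:E = \int[lebesgue_rV d]_x (k x * profile A rho x)%:E)%E.
  by rewrite -(integral_density mp p0 mE)// fineK//; exact: integrable_fin_num.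
have M2E : (second_moment%:E =
    \int[lebesgue_rV d]_x (sqnorm x * profile A rho x)%:E)%E.
  rewrite -(integral_density mp p0 mE)// fineK//; apply: integrable_fin_num => //.
  exact: integrable_sqnorm.
pose ks (x : 'rV[R]_d) := Num.max (rho ^+ 2 - s ^- 2 * sqnorm x) 0.
have mks : measurable_fun setT ks.
  by apply: measurable_maxr => //; apply: measurable_funB => //; exact: measurable_funM.
have ksE : ((s ^+ d * Fk)%:E = \int[lebesgue_rV d]_x (A * ks x ^+ 2)%:E)%E.
  rewrite (@ge0_lebesgue_rV_affine _ _ s 0) ?gt_eqF//; last 2 first.
  - by apply/measurable_EFinP; apply: measurable_funM => //; exact: measurable_funX.
  - by move=> x; rewrite lee_fin mulr_ge0 ?sqr_ge0// ltW.
  rewrite gtr0_norm// EFinM FkE; congr (_ * _)%E; apply: eq_integral => x _.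
  rewrite /ks /affine addr0 sqnormZ mulKf ?expf_neq0 ?gt_eqF//.
  by congr EFin; rewrite /profile /k; ring.
have sq_p0 (x : 'rV[R]_d) : 0 <= sqnorm x * profile A rho x.
  by apply: mulr_ge0; [exact: sqnorm_ge0|exact: p0].
have msqp : measurable_fun setT
    (fun x : 'rV[R]_d => sqnorm x * profile A rho x).
  exact: measurable_funM.
have s20 : 0 <= 2 * s ^- 2 by rewrite mulr_ge0// invr_ge0 sqr_ge0.
rewrite -lee_fin EFinD (EFinD (_ * _)) ksE !EFinM M2E FkE.
rewrite -!ge0_integralZl ?lee_fin//; last 4 first.
- exact/measurable_EFinP.
- by move=> x _; rewrite lee_fin.
- exact/measurable_EFinP.
- by move=> x _; rewrite lee_fin.
have mkp : measurable_fun setT (fun x : 'rV[R]_d => k x * profile A rho x).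
  exact: measurable_funM.
have mks2 : measurable_fun setT (fun x : 'rV[R]_d => A * ks x ^+ 2).
  by apply: measurable_funM => //; exact: measurable_funX.
rewrite -!ge0_integralD//; last 8 first.
- by move=> x _; rewrite lee_fin mulr_ge0 ?sqr_ge0// ltW.
- exact/measurable_EFinP.
- by move=> x _; rewrite -!EFinM lee_fin mulr_ge0.
- by under eq_fun do rewrite -!EFinM; apply/measurable_EFinP; exact: measurable_funM.
- by move=> x _; rewrite lee_fin mulr_ge0.
- exact/measurable_EFinP.
- by move=> x _; rewrite -!EFinM lee_fin mulr_ge0.
- by under eq_fun do rewrite -!EFinM; apply/measurable_EFinP; exact: measurable_funM.
apply: ge0_le_integral => //.
- by move=> x _; rewrite -!EFinM -!EFinD lee_fin addr_ge0// mulr_ge0.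
- under eq_fun do rewrite -!EFinM -!EFinD; apply/measurable_EFinP.
  by apply: measurable_funD => //; exact: measurable_funM.
- under eq_fun do rewrite -!EFinM -!EFinD; apply/measurable_EFinP.
  by apply: measurable_funD => //; exact: measurable_funM.
move=> x _; rewrite -!EFinM -!EFinD lee_fin /profile -/(k x).
have ksx : rho ^+ 2 - s ^- 2 * sqnorm x <= ks x by rewrite le_max lexx.
have kk : k x * (rho ^+ 2 - sqnorm x) = k x ^+ 2.
  by rewrite /k; case: leP => _; rewrite ?mul0r ?expr0n// expr2.
have h1 : 0 <= k x * (ks x - (rho ^+ 2 - s ^- 2 * sqnorm x)).
  by rewrite mulr_ge0// subr_ge0.
have h2 : 0 <= (ks x - k x) ^+ 2 by exact: sqr_ge0.
(* the difference is a sum of a square, the defect of [ks] over the affine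
   function, and the relation [k * k = k * (rho^2 - |x|^2)] *)
rewrite -subr_ge0.
rewrite (_ : _ - _ = A * ((ks x - k x) ^+ 2 +
  2 * (k x * (ks x - (rho ^+ 2 - s ^- 2 * sqnorm x))) +
  2 * (k x * (rho ^+ 2 - sqnorm x) - k x ^+ 2))); last by ring.
by rewrite kk subrr mulr0 addr0 mulr_ge0 ?(ltW hA)// addr_ge0// mulr_ge0.
Qed.

(** Dilating [k = max (rho^2 - |x|^2) 0] by [s] multiplies the integral of [k^2]
    by [s^d].  On the other hand the dilated square is a convex function of
    [s^-2], hence lies above its tangent at [s = 1] ([dilation_ineq]).  So
    [s^d Fk + 2 s^-2 second_moment] is minimal at [s = 1], where its derivative
    [d Fk - 4 second_moment] must vanish.  This is the integration by parts
    [d (int k^2) = 4 (int |x|^2 k)] without boundary terms. *)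
Lemma virial : d%:R * Fk = 4 * second_moment.
Proof.
pose phi (s : R) := s ^+ d * Fk + 2 * s ^- 2 * second_moment.
have dphi (s : R) : 0 < s -> is_derive s 1 phi
    (d%:R * s ^+ d.-1 * Fk - 4 * s ^- 3 * second_moment).
  move=> s0; have sn0 : s != 0 by rewrite gt_eqF.
  have dX : is_derive s 1 (fun x : R => x ^+ d) (d%:R * s ^+ d.-1).
    apply: DeriveDef; first exact: exprn_derivable.
    by rewrite exp_derive /GRing.scale/= mulr1.
  have dV : is_derive s 1 (fun x : R => x ^- 2) (- 2 * s ^- 3).
    have dX2 : derivable (fun x : R => x ^+ 2) s 1 by exact: exprn_derivable.
    have s2 : s ^+ 2 != 0 by rewrite expf_neq0.
    apply: DeriveDef; first exact: (@derivableV _ _ (fun x : R => x ^+ 2) s 1 s2).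
    rewrite (@deriveV _ _ (fun x : R => x ^+ 2) s 1 s2)//.
    rewrite exp_derive /GRing.scale/= expr1 mulr1.
    by field.
  have -> : phi = (Fk \*: (fun x : R => x ^+ d : R)) +
       ((2 * second_moment) \*: (fun x : R => x ^- 2 : R)).
    by apply/funext => x; transitivity
      (Fk * x ^+ d + 2 * second_moment * x ^- 2); first by rewrite /phi; ring.
  by apply: (is_derive_eq (is_deriveD (is_deriveZ Fk dX)
    (is_deriveZ (2 * second_moment) dV)));
    rewrite -[LHS]/(Fk * (d%:R * s ^+ d.-1) + 2 * second_moment * (-2 * s ^- 3));
    ring.
have d1 : is_derive (1:R) 1 phi 0.
  apply: (@derive1_at_min _ _ 0 2) => //.
  - by move=> t; rewrite in_itv/= => /andP[t0 _]; case: (dphi _ t0).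
  - by rewrite in_itv/= ltr01 ltr1n.
  - move=> t; rewrite in_itv/= => /andP[t0 _].
    have := dilation_ineq t0; rewrite /phi !expr1n invr1 mul1r mulr1.
    by [].
have [_] := d1; have [_ ->] := dphi 1 ltr01.
rewrite !expr1n invr1 !mulr1 => /eqP; rewrite subr_eq0 => /eqP.
by [].
Qed.

(** On the ball [k = rho^2 - |x|^2], and [m] has mass 1. *)
Lemma integral_dome : Fk = rho ^+ 2 - second_moment.
Proof.
rewrite /Fk /Rintegral.
rewrite (eq_integral_ball hm (g := fun x => rho ^+ 2 - sqnorm x))//; last 2 first.
- exact: measurable_funB.
- by move=> x xB; rewrite /k (max_idPl _)// subr_ge0 ltW.
rewrite -[LHS]/(\int[m]_x (rho ^+ 2 - sqnorm x)) RintegralB//.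
- rewrite Rintegral_cst// [X in fine X](_ : _ = 1%E) ?mulr1//.
  exact: probability_setT.
- by apply: (integrable_on_ball hm (M := `|rho ^+ 2|)) => //.
- exact: integrable_sqnorm.
Qed.

Lemma second_momentE : second_moment = d%:R * rho ^+ 2 / (d + 4)%:R.
Proof.
have := virial; rewrite integral_dome => h.
have d4 : (d + 4)%:R != 0 :> R by rewrite pnatr_eq0 addnC.
apply: (mulIf d4); rewrite divfK// natrD.
lra.
Qed.

Lemma profile_energy : \int[m]_x profile A rho x = 4 * A * rho ^+ 2 / (d + 4)%:R.
Proof.
rewrite -[LHS]/(\int[m]_x (A * k x)) RintegralZl//.
have d4 : (d + 4)%:R != 0 :> R by rewrite pnatr_eq0 addnC.
rewrite -/Fk integral_dome second_momentE natrD; field.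
by rewrite -natrD.
Qed.

End moments.

(** * Calculus on the unit interval *)

Section derive01_basic.
Context {R : realType} {W : normedModType R}.
Implicit Types (f : R -> W) (t s : R) (l : W).

(** The filter of the definition, unfolded: one statement covers interior
    points and the one-sided derivatives at the endpoints. *)
Lemma diff_quotientP f t l :
  diff_quotient f t @ within `[0, 1] t^' --> l <->
  forall e : R, 0 < e -> exists2 k : R, 0 < k &
    forall s, 0 <= s <= 1 -> s != t -> `|s - t| < k ->
      `|l - diff_quotient f t s| < e.
Proof.
split=> [/cvgrPdist_lt fl e /fl|fl].
  move=> /nbhs_ballP[k /= k0 kt]; exists k => // s s01 st sk.
  by apply: kt => //=; rewrite /ball/= distrC.
apply/cvgrPdist_lt => e /fl[k k0 kt]; apply/nbhs_ballP; exists k => //= s.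
rewrite /ball/= distrC => sk st; rewrite in_itv/= => s01.
exact: kt.
Qed.

(** Limits along this filter are unique only because it is proper, which is
    where the position of [t] in [[0, 1]] matters. *)
Lemma within01_dnbhs_proper t : 0 <= t <= 1 ->
  ProperFilter (within `[0, 1] t^').
Proof.
move=> t01; apply: Build_ProperFilter_ex => P /nbhs_ballP[k /= k0 kP].
have [s [s01 st sk]] : exists s : R, [/\ 0 <= s <= 1, s != t & `|s - t| < k].
  (* move towards the middle of the interval, to stay inside it *)
  pose h := Num.min (k / 2) (1 / 2).
  have [h0 hk h1] : [/\ 0 < h, h < k & h <= 1 / 2].
    by rewrite /h /Num.min; case: ifP => ?; split; lra.
  have [tle|tgt] := leP t (1 / 2).
    exists (t + h); split; [lra|by rewrite gt_eqF//; lra|].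
    by rewrite addrAC subrr add0r gtr0_norm.
  exists (t - h); split; [lra|by rewrite lt_eqF//; lra|].
  by rewrite addrAC subrr add0r normrN gtr0_norm.
by exists s; apply: kP => //=; rewrite /ball/= distrC.
Qed.

Lemma derivable01P f t : derivable01 f t ->
  diff_quotient f t @ within `[0, 1] t^' --> derive01 f t.
Proof. by []. Qed.

Lemma derive01_unique f t l : 0 <= t <= 1 ->
  diff_quotient f t @ within `[0, 1] t^' --> l ->
  derivable01 f t /\ derive01 f t = l.
Proof.
move=> t01 fl; have := within01_dnbhs_proper t01 => PF.
by split; [apply/cvg_ex; exists l|apply/cvg_lim].
Qed.

Lemma derivable01_cvg f t : derivable01 f t ->
  forall e : R, 0 < e -> exists2 k : R, 0 < k &
    forall s, 0 <= s <= 1 -> `|s - t| < k -> `|f t - f s| < e.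
Proof.
move=> /derivable01P /diff_quotientP/(_ 1 ltr01)[k k0 kt] e e0.
pose M := `|derive01 f t| + 1.
have M0 : 0 < M by rewrite /M ltr_wpDl.
exists (Num.min k (e / M)); first by rewrite lt_min k0 divr_gt0.
move=> s s01; rewrite lt_min => /andP[sk se].
have [->|st] := eqVneq s t; first by rewrite subrr normr0.
have st0 : s - t != 0 by rewrite subr_eq0.
have qM : `|diff_quotient f t s| <= M.
  have := kt s s01 st sk; rewrite /M => h.
  rewrite -[diff_quotient f t s](subKr (derive01 f t)).
  by rewrite (le_trans (ler_normB _ _))// lerD2l ltW.
have -> : f t - f s = - (s - t) *: diff_quotient f t s.
  by rewrite /diff_quotient scalerA mulNr divff// scaleN1r opprB.
rewrite normrZ normrN; apply: (@le_lt_trans _ _ (`|s - t| * M)).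
  exact: ler_wpM2l.
by rewrite -ltr_pdivlMr.
Qed.

Lemma derivable01_continuous f : (forall t, 0 <= t <= 1 -> derivable01 f t) ->
  {within `[0, 1], continuous f}.
Proof.
move=> df; apply/continuous_within_itvP; first exact: ltr01.
split.
- move=> t; rewrite in_itv/= => /andP[t0 t1]; apply/cvgrPdist_lt => e e0.
  have t01 : 0 <= t <= 1 by rewrite !ltW.
  have [k k0 kt] := derivable01_cvg (df _ t01) e0.
  have m0 : 0 < Num.min k (Num.min t (1 - t)) by rewrite !lt_min k0 t0 subr_gt0.
  apply/nbhs_ballP; exists (Num.min k (Num.min t (1 - t))) => // s.
  rewrite /ball/= !lt_min distrC => /and3P[sk]; rewrite !ltr_norml.
  move=> /andP[? ?] /andP[? ?]; apply: kt => //; lra.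
- apply/cvgrPdist_lt => e e0.
  have [|k k0 kt] := derivable01_cvg (df 0 _) e0; first by rewrite lexx ler01.
  near=> s.
  have s0 : 0 < s by near: s; exact: nbhs_right_gt.
  have s1 : s < 1 by near: s; exact: nbhs_right_lt.
  have sk : s < k by near: s; exact: nbhs_right_lt.
  by apply: kt; [lra|rewrite subr0 gtr0_norm].
- apply/cvgrPdist_lt => e e0.
  have [|k k0 kt] := derivable01_cvg (df 1 _) e0; first by rewrite lexx ler01.
  near=> s.
  have s0 : 0 < s by near: s; exact: nbhs_left_gt.
  have s1 : s < 1 by near: s; exact: nbhs_left_lt.
  have sk : 1 - k < s by near: s; apply: nbhs_left_gt; lra.
  by apply: kt; [lra|rewrite distrC gtr0_norm; lra].
Unshelve. all: by end_near. Qed.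

Lemma derive01_cst f l t : 0 <= t <= 1 ->
  (forall s, 0 <= s <= 1 -> f s = l) -> derive01 f t = 0.
Proof.
move=> t01 fl; apply: (@derive01_unique f t 0 t01 _).2.
apply/diff_quotientP => e e0; exists 1 => // s s01 st _.
by rewrite /diff_quotient !fl// subrr scaler0 subr0 normr0.
Qed.

Lemma derive01_affine f a b t : 0 <= t <= 1 ->
  (forall s, 0 <= s <= 1 -> f s = a + s *: b) -> derive01 f t = b.
Proof.
move=> t01 fl; apply: (@derive01_unique f t b t01 _).2.
apply/diff_quotientP => e e0; exists 1 => // s s01 st _.
rewrite /diff_quotient !fl// opprD addrACA subrr add0r -scalerBl scalerA mulVf ?subr_eq0//.
by rewrite scale1r subrr normr0.
Qed.

Lemma is_derive_derive01 f t : 0 < t < 1 -> derivable01 f t ->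
  is_derive t 1 f (derive01 f t).
Proof.
move=> /andP[t0 t1] /derivable01P/diff_quotientP ft.
suff h : h^-1 *: ((f \o shift t) (h *: 1) - f t) @[h --> 0^'] --> derive01 f t.
  by apply: DeriveDef; [apply/cvg_ex; exists (derive01 f t)|exact/cvg_lim].
apply/cvgrPdist_lt => e e0; have [k k0 kt] := ft _ e0.
apply/nbhs_ballP; exists (Num.min k (Num.min t (1 - t))).
  by rewrite /= !lt_min k0 t0 subr_gt0.
move=> h; rewrite /ball/= sub0r normrN !lt_min => /and3P[hk].
rewrite !ltr_norml => /andP[? ?] /andP[? ?] h0.
have := kt (h + t); rewrite /diff_quotient addrK [h *: 1]mulr1; apply => //; first lra.
by rewrite -subr_eq0 addrK.
Qed.

Lemma derive01_ext f g t :
  0 <= t <= 1 -> (forall s, 0 <= s <= 1 -> f s = g s) -> derivable01 f t ->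
  derivable01 g t /\ derive01 g t = derive01 f t.
Proof.
move=> t01 fg /derivable01P/diff_quotientP df; apply: derive01_unique => //.
apply/diff_quotientP => e /df[k k0 kt]; exists k => // s s01 st sk.
by rewrite /diff_quotient -!fg//; exact: kt.
Qed.

Lemma within01_bounded f :
  {within `[0, 1], continuous f} ->
  exists2 M, 0 <= M & forall t, 0 <= t <= 1 -> `|f t| <= M.
Proof.
move=> cf; have [|c _ cmax] := @EVT_max R (fun x => `|f x|) 0 1 ler01.
  move=> x; exact: (continuous_comp (cf x) (@norm_continuous R W (f x))).
by exists `|f c| => // t t01; apply: cmax; rewrite in_itv.
Qed.

Lemma derive01_segment f a b t :
  (forall s, 0 <= s <= 1 -> f s = (1 - s) *: a + s *: b) -> 0 <= t <= 1 ->
  derive01 f t = b - a /\ derive01 (derive01 f) t = 0.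
Proof.
move=> fE t01.
have df s : 0 <= s <= 1 -> derive01 f s = b - a.
  move=> s01; apply: (derive01_affine (a := a)) => // s' /fE ->.
  by rewrite scalerBl scale1r scalerBr addrA addrAC.
by split; [exact: df|exact: (derive01_cst (l := b - a))].
Qed.

End derive01_basic.

Section derive01_real.
Context {R : realType}.
Implicit Types (f : R -> R) (t s : R).

Lemma derive01Ml (a : R) f t : 0 <= t <= 1 -> derivable01 f t ->
  derive01 (fun s => a * f s) t = a * derive01 f t.
Proof.
move=> t01 ft; apply: (@derive01_unique R _ _ t _ t01 _).2.
rewrite (_ : diff_quotient _ _ = fun s => a * diff_quotient f t s).
  by apply: cvgM; [exact: cvg_cst|exact: ft].
by apply/funext => s; rewrite /diff_quotient -mulrBr /GRing.scale/= mulrCA.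
Qed.

Lemma derivable01_coord n (f : R -> 'rV[R]_n) t i : 0 <= t <= 1 ->
  derivable01 f t ->
  derivable01 (fun s => f s 0 i) t /\
  derive01 (fun s => f s 0 i) t = derive01 f t 0 i.
Proof.
move=> t01 /derivable01P ft; apply: derive01_unique => //.
rewrite (_ : diff_quotient _ _ = fun s => diff_quotient f t s 0 i).
  have PF := within01_dnbhs_proper t01.
  exact: (@continuous_cvg _ _ _ _ _ (diff_quotient f t)
    (fun x : 'rV[R]_n => x 0 i) _ (@coord_continuous R 1 n 0 i _) ft).
by apply/funext => s; rewrite /diff_quotient !mxE.
Qed.

Lemma MVT_itv f g (a b : R) : a < b ->
  {within `[a, b], continuous f} ->
  (forall t, a < t < b -> is_derive t 1 f (g t)) ->
  exists2 c, a < c < b & f b - f a = g c * (b - a).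
Proof.
move=> ab cf df; have [c cab ->] := MVT ab (fun x => df x) cf.
by exists c => //; move: cab; rewrite in_itv.
Qed.

(** The derivative is strictly decreasing, so the mean slope before an
    intermediate point exceeds the mean slope after it. *)
Lemma strictly_concave01_derive f :
  (forall t, 0 <= t <= 1 -> derivable01 f t) ->
  (forall t, 0 <= t <= 1 -> derivable01 (derive01 f) t) ->
  (forall t, 0 < t < 1 -> derive01 (derive01 f) t < 0) -> strictly_concave01 f.
Proof.
move=> df ddf neg.
have slope := MVT_itv.
have cf := derivable01_continuous df.
have cdf := derivable01_continuous ddf.
have sub (a b : R) : 0 <= a -> b <= 1 -> `[a, b] `<=` `[0, 1]%classic.
  move=> a0 b1 x /=; rewrite !in_itv/= => /andP[? ?]; apply/andP; split; lra.
have anti (a b : R) : 0 <= a -> a < b -> b <= 1 -> derive01 f b < derive01 f a.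
  move=> a0 ab b1.
  have [|c /andP[ac cb]] := slope _ (derive01 (derive01 f)) a b ab
      (continuous_subspaceW (sub _ _ a0 b1) cdf).
    move=> t /andP[ta tb]; apply: is_derive_derive01; first lra.
    by apply: ddf; lra.
  have : derive01 (derive01 f) c < 0 by apply: neg; lra.
  by move=> c0 fab; rewrite -subr_lt0 fab nmulr_rlt0// subr_gt0.
have conc (a b k : R) : 0 <= a -> a < b -> b <= 1 -> 0 < k < 1 ->
    k * f a + (1 - k) * f b < f (k * a + (1 - k) * b).
  move=> a0 ab b1 /andP[k0 k1]; set x := k * a + _.
  have ax : a < x.
    rewrite -subr_gt0 (_ : _ - _ = (1 - k) * (b - a)); last by rewrite /x; ring.
    by rewrite mulr_gt0// subr_gt0.
  have xb : x < b.
    rewrite -subr_gt0 (_ : _ - _ = k * (b - a)); last by rewrite /x; ring.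
    by rewrite mulr_gt0// subr_gt0.
  have x1 : x <= 1 by lra.
  have x0 : 0 <= x by lra.
  have [|c /andP[ac cx] fax] := slope f (derive01 f) a x ax
      (continuous_subspaceW (sub _ _ a0 x1) cf).
    by move=> t /andP[? ?]; apply: is_derive_derive01; [lra|apply: df; lra].
  have [|c' /andP[xc cb] fxb] := slope f (derive01 f) x b xb
      (continuous_subspaceW (sub _ _ x0 b1) cf).
    by move=> t /andP[? ?]; apply: is_derive_derive01; [lra|apply: df; lra].
  have cc : derive01 f c' < derive01 f c by apply: anti; lra.
  rewrite -subr_gt0 (_ : _ - _ = k * (f x - f a) - (1 - k) * (f b - f x)); last by ring.
  rewrite fax fxb (_ : _ - _ = (k * (1 - k) * (b - a)) * (derive01 f c - derive01 f c')).
    by rewrite mulr_gt0 ?subr_gt0// !mulr_gt0 ?subr_gt0.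
  by rewrite /x; ring.
move=> s t k /andP[s0 s1] /andP[t0 t1] st /andP[k0 k1].
have [lt_st|lt_ts|/eqP] := ltgtP s t; last by rewrite (negbTE st).
  by apply: conc => //; rewrite k0.
have k'01 : 0 < 1 - k < 1 by lra.
by have := conc t s (1 - k) t0 lt_ts s1 k'01; rewrite subKr [X in X < _]addrC [_ + k * s]addrC.
Qed.

Lemma derive01_0_cst f (a b : R) : 0 <= a -> b <= 1 ->
  (forall t, 0 <= t <= 1 -> derivable01 f t) ->
  (forall t, a < t < b -> derive01 f t = 0) ->
  forall s t, a <= s <= b -> a <= t <= b -> f s = f t.
Proof.
move=> a0 b1 df f0.
have lt_case s t : a <= s -> s < t -> t <= b -> f s = f t.
  move=> sa st tb; have [||c /andP[? ?]] := @MVT_itv f (derive01 f) s t st.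
  - apply: continuous_subspaceW (derivable01_continuous df) => x /=.
    by rewrite !in_itv/= => /andP[? ?]; apply/andP; split; lra.
  - by move=> x /andP[? ?]; apply: is_derive_derive01; [lra|apply: df; lra].
  - by rewrite f0 ?mul0r; [move=> /eqP; rewrite subr_eq0 => /eqP|lra].
move=> s t /andP[? ?] /andP[? ?].
by have [st|ts|->//] := ltgtP s t; [|symmetry]; exact: lt_case.
Qed.

(** The derivative is a constant, namely its value at 0; subtracting the linear
    function with this slope leaves a function with zero derivative. *)
Lemma derive01_twice0_affine f : (forall t, 0 <= t <= 1 -> derivable01 f t) ->
  (forall t, 0 <= t <= 1 -> derivable01 (derive01 f) t) ->
  (forall t, 0 < t < 1 -> derive01 (derive01 f) t = 0) ->
  forall t, 0 <= t <= 1 -> f t = (1 - t) * f 0 + t * f 1.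
Proof.
move=> df ddf f0.
have z01 : 0 <= (0:R) <= 1 by rewrite lexx ler01.
have o01 : 0 <= (1:R) <= 1 by rewrite lexx ler01.
have cst1 t : 0 <= t <= 1 -> derive01 f t = derive01 f 0.
  by move=> t01; exact: (derive01_0_cst (lexx 0) (lexx 1) ddf).
(* [g] has derivative 0, hence is constant *)
pose g t := f t - t * derive01 f 0.
have dg t : 0 <= t <= 1 -> derivable01 g t /\ derive01 g t = 0.
  move=> t01; apply: derive01_unique => //.
  have : diff_quotient f t s @[s --> within `[0, 1] t^'] --> derive01 f 0.
    by rewrite -(cst1 _ t01); exact: df.
  move=> /diff_quotientP ft; apply/diff_quotientP => e /ft[k k0 kt].
  exists k => // s s01 st sk; have := kt s s01 st sk.
  have st0 : s - t != 0 by rewrite subr_eq0.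
  rewrite sub0r normrN distrC; congr (_ < _); congr `|_|.
  by rewrite /diff_quotient /g /GRing.scale/=; field.
have gE t : 0 <= t <= 1 -> g t = g 0.
  move=> t01; apply: (@derive01_0_cst g 0 1) => // s.
    by move=> /dg[].
  by move=> /andP[? ?]; apply: (dg s _).2; lra.
move=> t t01; have := gE _ t01; have := gE _ o01; rewrite /g mul1r mul0r subr0.
move=> h1 ht; have -> : f t = f 0 + t * derive01 f 0 by rewrite -ht subrK.
by rewrite -h1; ring.
Qed.

Lemma near_in01 (t : R) : 0 < t < 1 -> \forall s \near t, 0 <= s <= 1.
Proof.
move=> /andP[t0 t1]; near=> s; apply/andP; split; apply: ltW.
  by near: s; exact: lt_nbhsr.
by near: s; exact: lt_nbhsl.
Unshelve. all: by end_near. Qed.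

Lemma C2_01_affineP (d : nat) (f : R -> 'rV[R]_d) : C2_01 f ->
  (forall t, 0 < t < 1 -> derive01 (derive01 f) t = 0) ->
  forall t, 0 <= t <= 1 -> f t = (1 - t) *: f 0 + t *: f 1.
Proof.
move=> [df ddf _] f0 t t01; apply/rowP => i; rewrite !mxE.
have dfi s : 0 <= s <= 1 -> derivable01 (fun s => f s 0 i) s /\
    derive01 (fun s => f s 0 i) s = derive01 f s 0 i.
  by move=> s01; apply: derivable01_coord => //; exact: df.
have ddfi s : 0 <= s <= 1 -> derivable01 (derive01 (fun s => f s 0 i)) s /\
    derive01 (derive01 (fun s => f s 0 i)) s = derive01 (derive01 f) s 0 i.
  move=> s01; have [h1 h2] := derivable01_coord i s01 (ddf _ s01).
  rewrite -h2; apply: derive01_ext => // s' s'01.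
  by rewrite (dfi _ s'01).2.
apply: (@derive01_twice0_affine (fun s => f s 0 i)) => //.
- by move=> s /dfi[].
- by move=> s /ddfi[].
- move=> s s01; have s01' : 0 <= s <= 1 by lra.
  by rewrite (ddfi _ s01').2 f0// mxE.
Qed.

End derive01_real.

Section clamp01.
Context {R : realType}.
Implicit Types s t : R.

(** Precomposition with this retraction extends functions on the closed unit
    interval to the line, so that results about open intervals apply up to
    the endpoints. *)
Definition clamp01 (t : R) : R := Num.max 0 (Num.min t 1).

Lemma clamp01_in t : 0 <= clamp01 t <= 1.
Proof.
by rewrite /clamp01 le_max lexx/= ge_max ler01/= ge_min lexx orbT.
Qed.

Lemma clamp01_id t : 0 <= t <= 1 -> clamp01 t = t.
Proof. by move=> /andP[t0 t1]; rewrite /clamp01 (min_idPl t1) (max_idPr t0). Qed.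

Lemma clamp01_lip s t : `|clamp01 s - clamp01 t| <= `|s - t|.
Proof.
have h1 := ler_norm (s - t); have h2 := ler_norm (t - s).
rewrite distrC in h2; rewrite ler_norml /clamp01.
have [?|?] := leP s 1; have [?|?] := leP t 1.
- by have [?|?] := leP 0 s; have [?|?] := leP 0 t; apply/andP; split; lra.
- by rewrite (max_idPr ler01); have [?|?] := leP 0 s; apply/andP; split; lra.
- by rewrite (max_idPr ler01); have [?|?] := leP 0 t; apply/andP; split; lra.
- by rewrite subrr; apply/andP; split; lra.
Qed.

Lemma clamp01_continuous (W : normedModType R) (f : R -> W) :
  (forall t, 0 <= t <= 1 -> derivable01 f t) -> continuous (f \o clamp01).
Proof.
move=> df t; apply/cvgrPdist_lt => e e0.
have [k k0 kf] := derivable01_cvg (df _ (clamp01_in t)) e0.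
apply/nbhs_ballP; exists k => //= s; rewrite /ball/= distrC => sk.
apply: kf; first exact: clamp01_in.
exact: le_lt_trans (clamp01_lip _ _) sk.
Qed.

End clamp01.

(** * Acceleration forced by conservation of energy *)

Section conserved_energy.
Context {R : realType}.
Variables (f : R -> R) (n : nat) (P W C : R).
Hypothesis fC2 : C2_01 f.
Hypothesis f_energy : forall t, 0 <= t <= 1 ->
  f t ^+ (2 * n) * (P * derive01 f t ^+ 2 + W) = C.

Let G t := P * derive01 (derive01 f) t * f t ^+ (2 * n).+1 + n%:R * C.

Let derivative_energy t : 0 < t < 1 -> derive01 f t * G t = 0.
Proof.
move=> t01; have [df ddf _] := fC2.
have t01' : 0 <= t <= 1 by lra.
have Df := is_derive_derive01 t01 (df _ t01').
have DDf := is_derive_derive01 t01 (ddf _ t01').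
pose E := f ^+ (2 * n) * (P \*: (derive01 f ^+ 2) + cst W).
have DE := is_deriveM (is_deriveX (2 * n) Df)
  (is_deriveD (is_deriveZ P (is_deriveX 2 DDf)) (is_derive_cst W t 1)).
have DE0 : is_derive t 1 E 0.
  apply: (@near_eq_is_derive _ _ _ (cst C)).
    near=> s; rewrite /cst -(@f_energy s); first by rewrite /E !fctE.
    apply/andP; split; apply: ltW.
      by near: s; apply: lt_nbhsr; case/andP: t01.
    by near: s; apply: lt_nbhsl; case/andP: t01.
have [_ DEv] := DE; have [_ DE0v] := DE0.
have {DE DE0 DEv DE0v} : f t ^+ (2 * n) * (P * (2 * derive01 f t * derive01 (derive01 f) t)) +
    (P * derive01 f t ^+ 2 + W) *
    ((2 * n)%:R * f t ^+ (2 * n).-1 * derive01 f t) = 0.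
  rewrite -[RHS]DE0v DEv !fctE; transitivity (f t ^+ (2 * n) *
    (P * (2%:R * derive01 f t ^+ 1 * derive01 (derive01 f) t) + 0) +
    (P * derive01 f t ^+ 2 + W) *
    ((2 * n)%:R * f t ^+ (2 * n).-1 * derive01 f t)) => //.
  by rewrite addr0 expr1.
move=> DE0.
rewrite /G -(f_energy t01').
have -> : n%:R * (f t ^+ (2 * n) * (P * derive01 f t ^+ 2 + W)) =
    (f t / 2) * ((P * derive01 f t ^+ 2 + W) * ((2 * n)%:R * f t ^+ (2 * n).-1)).
  case: (n) => [|k]; first by rewrite muln0 !mul0r !mulr0.
  rewrite natrM (_ : (2 * k.+1).-1 = (2 * k).+1)%N; last by rewrite mulnS.
  rewrite (_ : (2 * k.+1 = (2 * k).+2)%N); last by rewrite mulnS.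
  by rewrite !exprS; field.
(* [f t / 2] times the derivative of the conserved quantity *)
rewrite -[RHS](mulr0 (f t / 2)) -DE0 exprS.
set y := f t ^+ (2 * n); set z := f t ^+ (2 * n).-1; by field.
Unshelve. all: by end_near. Qed.

Let G_continuous t : 0 < t < 1 -> {for t, continuous G}.
Proof.
move=> t01; have [df ddf cddf] := fC2.
have t01' : t \in `]0, 1[ by rewrite in_itv.
have cf : {for t, continuous f}.
  exact: within_continuous_continuous ltr01 (derivable01_continuous df) t01'.
have cf2 : {for t, continuous (derive01 (derive01 f))}.
  exact: within_continuous_continuous ltr01 cddf t01'.
apply: cvgD; last exact: cvg_cst.
apply: cvgM; first by apply: cvgM; [exact: cvg_cst|exact: cf2].
exact: (continuous_comp cf (@exprn_continuous _ _ _)).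
Qed.

(** Differentiating the conserved quantity gives [f' * G = 0].  Where [G] does
    not vanish, neither does it nearby, so [f' = 0] on an interval and [f] is
    constant there, which strict concavity excludes. *)
Lemma acceleration_of_conserved_energy : strictly_concave01 f ->
  forall t, 0 < t < 1 ->
    P * derive01 (derive01 f) t * f t ^+ (2 * n).+1 = - (n%:R * C).
Proof.
move=> fconc t t01; apply/eqP; rewrite -addr_eq0; apply/eqP; rewrite -/(G t).
apply/eqP/negPn/negP => Gt0.
have /nbhs_ballP[k /= k0 kG] : \forall s \near t, G s != 0.
  by have /cvgr_neq0 := G_continuous t01; exact.
pose h := Num.min (k / 2) (Num.min (t / 2) ((1 - t) / 2)).
have /andP[t0 t1] := t01.
have h0 : 0 < h by rewrite !lt_min !divr_gt0// subr_gt0.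
have hk : h < k by rewrite /h gt_min; apply/orP; left; lra.
have ht : h <= t / 2 by rewrite /h !ge_min lexx orbT.
have ht1 : h <= (1 - t) / 2 by rewrite /h !ge_min lexx !orbT.
have [df _ _] := fC2.
have fc : forall s s', t - h <= s <= t + h -> t - h <= s' <= t + h -> f s = f s'.
  apply: derive01_0_cst => //; [lra|lra|move=> s /andP[s1 s2]].
  have s01 : 0 < s < 1 by apply/andP; split; lra.
  have /eqP := derivative_energy s01; rewrite mulf_eq0 => /orP[/eqP//|].
  have /negbTE -> // : G s != 0.
  by apply: kG; rewrite /ball/= distrC ltr_norml; apply/andP; split; lra.
have a01 : 0 <= t - h <= 1 by lra.
have b01 : 0 <= t + h <= 1 by lra.
have ab : t - h != t + h by rewrite lt_eqF//; lra.
have half01 : 0 < (2^-1 : R) < 1 by lra.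
have := fconc _ _ _ a01 b01 ab half01; have -> : 1 - 2^-1 = 2^-1 :> R by field.
have -> : 2^-1 * (t - h) + 2^-1 * (t + h) = t by field.
rewrite (fc (t - h) t) ?(fc (t + h) t); [|lra..].
by rewrite (_ : 2^-1 * f t + 2^-1 * f t = f t) ?ltxx//; field.
Qed.

End conserved_energy.

(** * Integrals along the self-similar curve *)

Section self_similar_integrals.
Context {R : realType} {d : nat} (Omega : set 'rV[R]_d).
Hypothesis mO : measurable Omega.
Context {A rho : R}.
Hypotheses (hA : 0 < A) (hrho : 0 < rho).
Variable m : probability 'rV[R]_d R.
Hypothesis hm : has_density m (profile A rho).
Variables (Rs : R -> R) (xbar : R -> 'rV[R]_d) (t : R).
Hypothesis Rt0 : 0 < Rs t.
Hypothesis supp : ssim_curve m Rs xbar t (~` Omega) = 0%E.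

Let mu := ssim_curve m Rs xbar.
Let u := ssim_density A rho Rs xbar.
Let v := ssim_velocity Rs xbar.
Let T := affine (Rs t) (xbar t).

Lemma ssim_has_density : has_density (mu t) (u t).
Proof. exact: has_density_affine. Qed.

Lemma Rintegral_ssim_curve (f : 'rV[R]_d -> R) : measurable_fun setT f ->
  \int[mu t]_(x in Omega) f x = \int[m]_x f (T x).
Proof. by move=> mf; congr fine; exact: integral_affine_push. Qed.

Lemma Rintegral_ssim_density (f : 'rV[R]_d -> R) : measurable_fun setT f ->
  \int[lebesgue_rV d]_(x in Omega) (f x * u t x) = \int[mu t]_(x in Omega) f x.
Proof.
move=> mf; have [mu_ u0 muE] := ssim_has_density; congr fine.
by rewrite (integral_density mu_ u0 muE)//; exact: measurable_funTS.
Qed.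

(** One factor [u] of [u^2] is the density of [mu_t]; the other one, pulled
    back by [T^t], is a multiple of the profile. *)
Lemma FfunE : Ffun Omega u t = (Rs t) ^- d * \int[m]_x profile A rho x.
Proof.
have [mu_ _ _] := ssim_has_density; have [mp _ _] := hm.
rewrite /Ffun; under eq_Rintegral do rewrite expr2.
rewrite Rintegral_ssim_density// Rintegral_ssim_curve//.
rewrite (@eq_Rintegral _ _ _ m setT (fun x => (Rs t) ^- d * profile A rho x)); last first.
  by move=> x _; rewrite /u /ssim_density /T affineK// gt_eqF.
rewrite RintegralZl//; apply: (integrable_on_ball hm (M := A * rho ^+ 2)) => // x xB.
rewrite /profile ger0_norm; last by rewrite mulr_ge0 ?(ltW hA)// le_max lexx orbT.
rewrite ler_pM2l// ge_max sqr_ge0 andbT; have := sqnorm_ge0 x; lra.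
Qed.

Lemma ssim_velocity_affine x :
  v t (T x) = derive01 Rs t *: x + derive01 xbar t.
Proof.
by rewrite /v /ssim_velocity /T /affine addrK scalerA divfK// gt_eqF.
Qed.

Lemma measurable_ssim_velocity : measurable_fun setT (v t).
Proof.
rewrite (_ : v t = affine (derive01 Rs t / Rs t)
  (derive01 xbar t - (derive01 Rs t / Rs t) *: xbar t)).
  exact: measurable_affine.
by apply/funext => x; rewrite /v /ssim_velocity /affine scalerBr addrAC addrA.
Qed.

Lemma integrable_sqnorm_affine a c :
  m.-integrable setT (fun x => (sqnorm (a *: x + c))%:E).
Proof.
have -> : (fun x => (sqnorm (a *: x + c))%:E) = (fun x => (a ^+ 2 * sqnorm x)%:E +
    (2 * a * dot x c)%:E + (sqnorm c)%:E)%E.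
  apply/funext => x.
  by rewrite sqnormD sqnormZ dotZl -!EFinD mulrA.
apply: integrableD => //; last first.
  by apply: (integrable_on_ball hm (f := cst (sqnorm c)) (M := `|sqnorm c|)).
apply: integrableD => //.
  under eq_fun do rewrite EFinM.
  by apply: integrableZl => //; exact: (integrable_sqnorm hm).
under eq_fun do rewrite EFinM.
by apply: integrableZl => //; exact: (integrable_dot hrho hm).
Qed.

(** The cross term of [|Rs' x + xbar'|^2] integrates to zero because the
    profile measure is centred. *)
Lemma VfunE : Vfun Omega u v t =
  derive01 Rs t ^+ 2 * second_moment m + sqnorm (derive01 xbar t).
Proof.
rewrite /Vfun (Rintegral_ssim_density (f := fun x => sqnorm (v t x))); last first.
  exact: (measurable_fun_sqnorm measurable_ssim_velocity).
rewrite (Rintegral_ssim_curve (f := fun x => sqnorm (v t x))); last first.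
  exact: (measurable_fun_sqnorm measurable_ssim_velocity).
under eq_Rintegral do rewrite ssim_velocity_affine sqnormD sqnormZ dotZl mulrA.
have ia := integrable_sqnorm hm.
have iab : m.-integrable setT (EFin \o (fun x => derive01 Rs t ^+ 2 * sqnorm x)).
  rewrite /comp; under eq_fun do rewrite EFinM.
  exact: integrableZl.
have ibb : m.-integrable setT (EFin \o
    (fun x => 2 * derive01 Rs t * dot x (derive01 xbar t))).
  rewrite /comp; under eq_fun do rewrite EFinM.
  by apply: integrableZl => //; exact: (integrable_dot hrho hm).
rewrite RintegralD//; last 2 first.
- by rewrite /comp; under eq_fun do rewrite EFinD; exact: integrableD.
- by apply: (integrable_on_ball hm (f := cst _) (M := `|sqnorm (derive01 xbar t)|)).
rewrite RintegralD// !RintegralZl//; last exact: (integrable_dot hrho hm).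
rewrite (mean_dot hrho hm) mulr0 addr0 Rintegral_cst//.
by rewrite [X in fine X](_ : _ = 1%E) ?mulr1//; exact: probability_setT.
Qed.

End self_similar_integrals.

(** * Gradients and compactly supported test functions *)

Section gradient.
Context {R : realType} {d : nat}.
Implicit Types (phi : 'rV[R]_d -> R) (x h : 'rV[R]_d).

Lemma diff_gradient phi x h : differentiable phi x ->
  'd phi x h = dot (gradient phi x) h.
Proof.
move=> dphi; rewrite {1}(row_sum_delta h) linear_sum /dot; apply: eq_bigr => i _.
by rewrite linearZ/= mxE deriveE// mulrC.
Qed.

Lemma is_derive_curve phi (c : R -> 'rV[R]_d) (t : R) (w : 'rV[R]_d) :
  differentiable phi (c t) -> is_derive t 1 c w ->
  is_derive t 1 (phi \o c) (dot (gradient phi (c t)) w).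
Proof.
move=> dphi [dc <-].
have dct : differentiable c t by exact/derivable1_diffP.
apply: DeriveDef; first exact/derivable1_diffP/differentiable_comp.
rewrite deriveE; last exact: differentiable_comp.
by rewrite diff_comp//= diff_gradient// deriveE.
Qed.

Lemma is_derive_comp_scalar (g : R -> R) (y : 'rV[R]_d -> R) x h dg :
  differentiable y x -> is_derive (y x) 1 g dg ->
  is_derive x h (g \o y) (dg * 'D_h y x).
Proof.
move=> dy [dg1 <-].
have dgy : differentiable g (y x) by exact/derivable1_diffP.
apply: DeriveDef; first exact/diff_derivable/differentiable_comp.
rewrite deriveE; last exact: differentiable_comp.
rewrite diff_comp//= (deriveE _ dy) (deriveE _ dgy) mulrC.
by rewrite -[RHS]/('d y x h *: 'd g (y x) 1) -linearZ/= [_ *: _]mulr1.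
Qed.

Lemma is_derive_affine_curve (r : R -> R) (c : R -> 'rV[R]_d) (t dr : R)
    (dc x : 'rV[R]_d) : is_derive t 1 r dr -> is_derive t 1 c dc ->
  is_derive t 1 (fun s => affine (r s) (c s) x) (dr *: x + dc).
Proof.
move=> [dr_ rE] dc_; apply: (@is_deriveD _ _ _ (fun s => r s *: x)).
have drt : differentiable r t by exact/derivable1_diffP.
apply: DeriveDef; first exact/derivable1_diffP/differentiableZl.
rewrite deriveE; last exact: differentiableZl.
by rewrite diffZl// -rE deriveE.
Qed.

Lemma gradient_outside_support phi x :
  ~ closure [set y | phi y != 0] x -> phi x = 0 /\ gradient phi x = 0.
Proof.
move=> nx.
have /(open_nbhs_nbhs) phi0 : open_nbhs x (~` closure [set y | phi y != 0]).
  by split=> //; apply: closed_openC; exact: closed_closure.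
have {}phi0 : \forall y \near x, phi y = 0.
  apply: filterS phi0 => y /= ny; apply/eqP/negPn/negP => phiy.
  by apply: ny; exact: subset_closure.
split; first exact: nbhs_singleton phi0.
apply/rowP => i; rewrite !mxE.
rewrite (@near_eq_derive _ _ _ _ (cst 0))//; exact: derive_cst.
Qed.

(** Used for a test function and for each component of its gradient. *)
Lemma compact_support_bounded phi (f : 'rV[R]_d -> R) :
  compact (closure [set x | phi x != 0]) -> continuous f ->
  (forall x, ~ closure [set y | phi y != 0] x -> f x = 0) ->
  exists2 M, 0 <= M & forall x, `|f x| <= M.
Proof.
move=> cS cf f0.
have [[x0 Sx0]|S0] := pselect (closure [set x | phi x != 0] !=set0).
  have [||c _ cmax] := @compact_EVT_max _ R (fun x => `|f x|) _ _ cS.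
  - by exists x0.
  - by apply: continuous_subspaceT => x; 
    exact: (continuous_comp (cf x) (@norm_continuous R R (f x))).
  exists `|f c| => // x.
  have [Sx|/f0 ->] := pselect (closure [set y | phi y != 0] x).
    by apply: cmax; rewrite inE.
  by rewrite normr0.
exists 0 => // x; rewrite f0 ?normr0// => Sx; apply: S0; by exists x.
Qed.

Lemma C1c_continuous phi : C1c phi -> continuous phi.
Proof. by move=> [dphi _ _] x; exact: differentiable_continuous. Qed.

Lemma C1c_bounded phi : C1c phi -> exists2 M, 0 <= M & forall x, `|phi x| <= M.
Proof.
move=> phiC; have [dphi cg cS] := phiC.
apply: (compact_support_bounded cS (C1c_continuous phiC)).
by move=> x /gradient_outside_support[].
Qed.

Lemma C1c_gradient_coord_continuous phi i : C1c phi ->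
  continuous (fun x => gradient phi x 0 i).
Proof.
move=> [_ cg _] x.
exact: (continuous_comp (cg x) (@coord_continuous R 1 d 0 i _)).
Qed.

Lemma C1c_gradient_bounded phi : C1c phi ->
  exists2 M, 0 <= M & forall x i, `|gradient phi x 0 i| <= M.
Proof.
move=> phiC; have [dphi cg cS] := phiC.
have /choice[M /all_and2[M0 hM]] : forall i, exists M, 0 <= M /\ forall x, `|gradient phi x 0 i| <= M.
  move=> i; have [|M M0 hM] := compact_support_bounded cS
      (C1c_gradient_coord_continuous (i := i) phiC).
    by move=> x /gradient_outside_support[_ ->]; rewrite mxE.
  by exists M.
exists (\sum_i M i); first exact: sumr_ge0.
move=> x i; apply: le_trans (hM i x) _; rewrite (bigD1 i)//= lerDl.
exact: sumr_ge0.
Qed.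

Lemma measurable_gradient phi : C1c phi -> measurable_fun setT (gradient phi).
Proof.
move=> phiC; apply: measurable_fun_rV => i.
exact: (continuous_measurable_rV (C1c_gradient_coord_continuous (i := i) phiC)).
Qed.

End gradient.

Section cutoff.
Context {R : realType}.
Implicit Types s : R.

(** The square of the positive part is continuously differentiable, unlike the
    positive part itself; composing it with itself gives a C^1 cutoff. *)
Definition sqpos s : R := Num.max s 0 ^+ 2.

Lemma is_derive_sqpos s : is_derive s 1 sqpos (2 * Num.max s 0).
Proof.
suff h : h^-1 *: ((sqpos \o shift s) (h *: 1) - sqpos s) @[h --> 0^'] -->
    2 * Num.max s 0.
  by apply: DeriveDef; [apply/cvg_ex; exists (2 * Num.max s 0)|exact/cvg_lim].
apply/cvgrPdist_lt => e e0; apply/nbhs_ballP; exists e => //= h.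
rewrite /ball/= sub0r normrN => he h0; apply: le_lt_trans he.
rewrite [h *: 1]mulr1 [_ *: _]mulrC.
set q := (_ - _) / h.
have qE : h * (2 * Num.max s 0 - q) = 2 * Num.max s 0 * h - (sqpos (h + s) - sqpos s).
  by rewrite /q /=; field.
(* the remainder is quadratic whatever the signs of [s] and [h + s] *)
have : `|h * (2 * Num.max s 0 - q)| <= h ^+ 2.
  rewrite qE /sqpos ler_norml.
  have [s0|s0] := leP s 0; have [hs|hs] := leP (h + s) 0; apply/andP; split; nra.
rewrite normrM -[h ^+ 2]real_normK ?num_real// expr2 ler_pM2l//.
by rewrite normr_gt0.
Qed.

Lemma is_derive_max0 (s : R) : 0 < s -> is_derive s 1 (fun x : R => Num.max x 0) 1.
Proof.
move=> s0; apply: near_eq_is_derive (is_derive_id s 1); near=> x.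
rewrite (max_idPl _)//; apply: ltW; near: x; exact: lt_nbhsr.
Unshelve. all: by end_near. Qed.

Definition cutoff s : R := sqpos (1 - sqpos s).

Definition dcutoff s : R := 2 * Num.max (1 - sqpos s) 0 * (- (2 * Num.max s 0)).

Lemma is_derive_cutoff s : is_derive s 1 cutoff (dcutoff s).
Proof.
have h : is_derive s 1 (fun x => 1 - sqpos x) (- (2 * Num.max s 0)).
  have := @is_deriveB _ _ _ (cst (1:R)) sqpos s 1 _ _ (is_derive_cst _ _ _)
    (is_derive_sqpos s).
  by rewrite sub0r.
exact: (@is_derive1_comp _ _ (fun x => 1 - sqpos x) _ _ _ (is_derive_sqpos _) h).
Qed.

(** The derivative vanishes as well on the closed half-line, including its
    endpoint: the gradient of a truncated potential is then right on the whole
    closed ball. *)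
Lemma cutoff1 s : s <= 0 -> cutoff s = 1 /\ dcutoff s = 0.
Proof.
move=> s0; rewrite /cutoff /dcutoff /sqpos (max_idPr s0) expr0n/= subr0.
by rewrite (max_idPl _)// expr1n !mulr0 oppr0 mulr0.
Qed.

Lemma cutoff0 s : 1 <= s -> cutoff s = 0.
Proof.
move=> s1; have s0 : 0 <= s by lra.
rewrite /cutoff {2}/sqpos (max_idPl s0) /sqpos (max_idPr _) ?expr0n//.
by rewrite subr_le0 exprn_ege1.
Qed.

Lemma sqpos_continuous : continuous sqpos.
Proof.
move=> s; apply/differentiable_continuous/derivable1_diffP.
by have [] := is_derive_sqpos s.
Qed.

Lemma max0_continuous : continuous (fun s : R => Num.max s 0).
Proof. by move=> s; apply: continuous_max; [exact: cvg_id|exact: cvg_cst]. Qed.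

Lemma cutoff_continuous : continuous cutoff.
Proof.
move=> s; apply/differentiable_continuous/derivable1_diffP.
by have [] := is_derive_cutoff s.
Qed.

Lemma dcutoff_continuous : continuous dcutoff.
Proof.
move=> s; apply: cvgM.
  apply: cvgM; first exact: cvg_cst.
  apply: (@continuous_comp _ _ _ (fun x => 1 - sqpos x) (fun x => Num.max x 0)).
    by apply: cvgB; [exact: cvg_cst|exact: sqpos_continuous].
  exact: max0_continuous.
apply: cvgN; apply: cvgM; first exact: cvg_cst.
exact: max0_continuous.
Qed.

End cutoff.

Section quadratic.
Context {R : realType} {d : nat}.
Implicit Types x h b : 'rV[R]_d.

Lemma dot_delta x i : dot x (delta_mx 0 i) = x 0 i.
Proof.
rewrite /dot (bigD1 i)//= big1 ?addr0; last first.
  by move=> j ji; rewrite !mxE eqxx (negbTE ji) mulr0.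
by rewrite !mxE !eqxx mulr1.
Qed.

Lemma differentiable_dot b x : differentiable (fun y => dot y b) x.
Proof.
rewrite (_ : (fun y => _) = \sum_(i < d) (fun y : 'rV[R]_d => y 0 i * b 0 i)).
  apply: differentiable_sum => i.
  apply: (@differentiableM _ _ (fun y : 'rV[R]_d => y 0 i) (cst (b 0 i))).
    exact: differentiable_coord.
  exact: differentiable_cst.
by apply/funext => y; rewrite fct_sumE.
Qed.

Lemma differentiable_sqnorm x : differentiable (@sqnorm R d) x.
Proof.
rewrite (_ : @sqnorm R d = \sum_(i < d) (fun y : 'rV[R]_d => y 0 i * y 0 i)).
  apply: differentiable_sum => i.
  apply: (@differentiableM _ _ (fun y : 'rV[R]_d => y 0 i) (fun y : 'rV[R]_d => y 0 i));
  exact: differentiable_coord.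
by apply/funext => y; rewrite fct_sumE.
Qed.

Lemma is_derive_dot b x h : is_derive x h (fun y => dot y b) (dot h b).
Proof.
apply: DeriveDef; first exact/diff_derivable/differentiable_dot.
apply/cvg_lim => //; apply: cvg_near_cst; near=> k.
rewrite /= dotDl dotZl addrK; have k0 : k != 0 by near: k; exact: nbhs_dnbhs_neq.
by rewrite [_ *: _]mulKf.
Unshelve. all: by end_near. Qed.

Lemma is_derive_sqnorm x h : is_derive x h (@sqnorm R d) (2 * dot x h).
Proof.
apply: DeriveDef; first exact/diff_derivable/differentiable_sqnorm.
apply/cvg_lim => //.
have -> : 2 * dot x h = 0 * sqnorm h + 2 * dot x h by rewrite mul0r add0r.
have near_eq : \forall k \near 0^', k * sqnorm h + 2 * dot x h =
    k^-1 *: ((@sqnorm R d \o shift x) (k *: h) - sqnorm x).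
  near=> k; have k0 : k != 0 by near: k; exact: nbhs_dnbhs_neq.
  rewrite /= sqnormD sqnormZ dotZl (dotC x) [RHS]mulrC; by field.
apply: cvg_trans (near_eq_cvg near_eq) _.
apply: cvgD; last exact: cvg_cst.
apply: cvgM; last exact: cvg_cst.
exact: cvg_within.
Unshelve. all: by end_near. Qed.

Lemma differentiable_sqnormB c x : differentiable (fun y => sqnorm (y - c)) x.
Proof.
apply: (@differentiable_comp _ _ _ _ (fun y => y - c) (@sqnorm R d)).
  exact: (@differentiableB _ _ _ id (cst c)).
exact: differentiable_sqnorm.
Qed.

Lemma is_derive_sqnormB c x h :
  is_derive x h (fun y => sqnorm (y - c)) (2 * dot (x - c) h).
Proof.
apply: DeriveDef; first exact/diff_derivable/differentiable_sqnormB.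
have [_ <-] := is_derive_sqnorm (x - c) h.
rewrite /derive; set F := (F in lim (F @ _) = _).
set G := (G in _ = lim (G @ _)).
by have -> : F = G by apply/funext => k; rewrite /F /G /= addrA.
Qed.

End quadratic.

Section test_function.
Context {R : realType} {d : nat}.
Implicit Types x h : 'rV[R]_d.

Variables (a L : R) (b c : 'rV[R]_d).
Hypothesis L0 : 0 < L.

Let psi x : R := a / 2 * sqnorm (x - c) + dot x b.
Let y x : R := L^-1 * sqnorm (x - c) - 1.

(** A quadratic potential with gradient [a (x - c) + b], cut off between the
    balls of squared radius [L] and [2 L] around [c]. *)
Definition potential x : R := psi x * cutoff (y x).

Let dpsi x h : is_derive x h psi (a * dot (x - c) h + dot h b).
Proof.
have H := @is_deriveD _ _ _ ((a / 2) \*: (fun z => sqnorm (z - c)))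
  (fun z => dot z b) x h _ _ (is_deriveZ (a / 2) (is_derive_sqnormB c x h))
  (is_derive_dot _ _ _).
apply: is_derive_eq H _; congr (_ + _).
by rewrite -[LHS]/(a / 2 * (2 * dot (x - c) h)); field.
Qed.

Let dy x h : is_derive x h y (L^-1 * (2 * dot (x - c) h)).
Proof.
have H := @is_deriveB _ _ _ (L^-1 \*: (fun z => sqnorm (z - c))) (cst 1) x h _ _
  (is_deriveZ L^-1 (is_derive_sqnormB c x h)) (is_derive_cst (1:R) x h).
by apply: is_derive_eq H _; rewrite subr0.
Qed.

Let diff_psi x : differentiable psi x.
Proof.
apply: (@differentiableD _ _ _ ((a / 2) \*: (fun z => sqnorm (z - c)))
  (fun z => dot z b)); last exact: differentiable_dot.
exact/differentiableZ/differentiable_sqnormB.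
Qed.

Let diff_y x : differentiable y x.
Proof.
apply: (@differentiableB _ _ _ (L^-1 \*: (fun z => sqnorm (z - c))) (cst 1)).
  exact/differentiableZ/differentiable_sqnormB.
exact: differentiable_cst.
Qed.

Let diff_potential x : differentiable potential x.
Proof.
apply: (@differentiableM _ _ psi (cutoff \o y)) => //.
apply: differentiable_comp => //; apply/derivable1_diffP.
by have [] := is_derive_cutoff (y x).
Qed.

Let gradient_potentialE : gradient potential = fun x =>
  cutoff (y x) *: (a *: (x - c) + b) +
  (psi x * dcutoff (y x) * (2 / L)) *: (x - c).
Proof.
apply/funext => x; apply/rowP => i; rewrite mxE.
have [_ dyE] := dy x (delta_mx 0 i).
have dcut := is_derive_comp_scalar (delta_mx 0 i) (diff_y x) (is_derive_cutoff (y x)).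
have [_ ->] := is_deriveM (dpsi x (delta_mx 0 i)) dcut.
rewrite dyE (dotC (delta_mx 0 i)) !dot_delta !mxE.
rewrite -[LHS]/(psi x * (dcutoff (y x) * (L^-1 * (2 * (x 0 i - c 0 i)))) +
  cutoff (y x) * (a * (x 0 i - c 0 i) + b 0 i)).
by ring.
Qed.

Let cont_y : continuous y.
Proof. by move=> x; exact: differentiable_continuous. Qed.

Lemma C1c_potential : C1c potential.
Proof.
split => //.
  rewrite gradient_potentialE => x.
  have c1 : {for x, continuous (fun z => cutoff (y z))}.
    exact: (@continuous_comp _ _ _ y cutoff x (@cont_y x) (@cutoff_continuous R (y x))).
  have c4 : {for x, continuous (fun z : 'rV[R]_d => z - c)}.
    exact: (@continuousB _ _ _ id (cst c) x cvg_id (@cst_continuous _ _ _ _)).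
  have c2 : {for x, continuous (fun z : 'rV[R]_d => a *: (z - c) + b)}.
    apply: (@continuousD _ _ _ (fun z : 'rV[R]_d => a *: (z - c)) (cst b)).
      exact: (@continuousZl_tmp _ _ _ _ a x c4).
    exact: cst_continuous.
  have c3 : {for x, continuous (fun z => psi z * dcutoff (y z) * (2 / L))}.
    apply: (@continuousM _ _ (fun z => psi z * dcutoff (y z)) (cst (2 / L))).
      apply: (@continuousM _ _ psi (fun z => dcutoff (y z))).
        exact: differentiable_continuous.
      exact: (@continuous_comp _ _ _ y dcutoff x (@cont_y x) (@dcutoff_continuous R (y x))).
    exact: cst_continuous.
  exact: (cvgD (continuousZ c1 c2) (continuousZ c3 c4)).
have sub : [set x | potential x != 0] `<=` y @^-1` [set z | z <= 1].
  move=> x /=; apply: contraNT; rewrite -ltNge => /ltW/cutoff0.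
  by rewrite /potential => ->; rewrite mulr0.
have cly : closed (y @^-1` [set z | z <= 1]).
  by apply: preimage_closed; [move=> x _; exact: cont_y|exact: (@closed_le R 1)].
apply: bounded_closed_compact; last exact: closed_closure.
have cly1 : closure [set x | potential x != 0] `<=` y @^-1` [set z | z <= 1].
  apply: subset_trans (closureS sub) _.
  by rewrite -((closure_id _).1 cly).
exists (`|c| + (2 * L + 1)); split; first exact: num_real.
move=> M ltM x /cly1 /=; rewrite /y => yx.
have {}yx : sqnorm (x - c) <= 2 * L.
  have : L^-1 * sqnorm (x - c) <= 2 by lra.
  by rewrite mulrC ler_pdivrMr.
apply: ltW; apply: le_lt_trans ltM.
rewrite -[x in `|x|](subrK c) addrC (le_trans (ler_normD _ _))// lerD2l.
rewrite [leLHS]/Num.Def.normr/= mx_normrE; apply: bigmax_le => [|[j i] _].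
  by rewrite addr_ge0// mulr_ge0// ltW.
rewrite ord1 /=; have := ler_coord_sqnorm (x - c) i.
set z := (x - c) 0 i => zx.
have {}zx : `|z| ^+ 2 <= 2 * L by rewrite real_normK ?num_real//; exact: le_trans yx.
have := normr_ge0 z; nra.
Qed.

Lemma gradient_potential x : sqnorm (x - c) <= L ->
  gradient potential x = a *: (x - c) + b.
Proof.
move=> xL; rewrite gradient_potentialE.
have /cutoff1[-> ->] : y x <= 0.
  by rewrite /y subr_le0 mulrC ler_pdivrMr// mul1r.
by rewrite scale1r mulr0 mul0r scale0r addr0.
Qed.

End test_function.

(** * Continuity equation and tangent field *)

Section differentiate_curve.
Context {R : realType} {d : nat}.
Context {A rho : R}.
Hypothesis hrho : 0 < rho.
Variable m : probability 'rV[R]_d R.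
Hypothesis hm : has_density m (profile A rho).
Variables (Rs : R -> R) (xbar : R -> 'rV[R]_d).
Hypotheses (RsC2 : C2_01 Rs) (xbarC2 : C2_01 xbar).

Let B : set 'rV[R]_d := [set x | sqnorm x < rho ^+ 2].

Lemma Rintegral_ball (f : 'rV[R]_d -> R) : measurable_fun setT f ->
  \int[m]_(x in B) f x = \int[m]_x f x.
Proof.
move=> mf; rewrite [LHS]Rintegral_mkcond; congr fine.
have mB := measurable_sqnorm_ball (R := R) (d := d) (rho := rho).
apply: (eq_integral_ball hm) => //.
  by apply: (measurable_restrictT _ mB).1; exact: measurable_funTS.
by move=> x xB; rewrite patchE mem_set.
Qed.

(** The derivative at time [s] of [phi (T^s x)] is bounded uniformly for [x] in
    the ball and [s] in the unit interval: the gradient of [phi] is bounded, and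
    so are the first derivatives of [Rs] and [xbar]. *)
Lemma is_derive_Rintegral_curve (phi : 'rV[R]_d -> R) (t : R) : C1c phi -> 0 < t < 1 ->
  is_derive t 1 (fun s => \int[m]_x phi (affine (Rs s) (xbar s) x))
    (\int[m]_x dot (gradient phi (affine (Rs t) (xbar t) x))
       (derive01 Rs t *: x + derive01 xbar t)).
Proof.
move=> phiC t01; have [dphi cg cS] := phiC.
have [dR ddR _] := RsC2; have [dx ddx _] := xbarC2.
have mB := measurable_sqnorm_ball (R := R) (d := d) (rho := rho).
have mphi : measurable_fun setT phi.
  exact: (continuous_measurable_rV (C1c_continuous phiC)).
have [Mphi Mphi0 hMphi] := C1c_bounded phiC.
have [Mg Mg0 hMg] := C1c_gradient_bounded phiC.
have [MR MR0 hMR] := within01_bounded (derivable01_continuous ddR).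
have [Mx Mx0 hMx] := within01_bounded (derivable01_continuous ddx).
pose F s x := phi (affine (Rs s) (xbar s) x).
have dF (s : R) x : 0 < s < 1 -> is_derive s 1 (F^~ x)
    (dot (gradient phi (affine (Rs s) (xbar s) x))
       (derive01 Rs s *: x + derive01 xbar s)).
  move=> s01; have s01' : 0 <= s <= 1 by lra.
  apply: is_derive_curve => //; apply: is_derive_affine_curve.
    by apply: is_derive_derive01 => //; exact: dR.
  by apply: is_derive_derive01 => //; exact: dx.
have It : `]0, 1[%classic t by rewrite /= in_itv.
(* [d] components, each at most a bound on the gradient times a bound on the velocity *)
pose G := cst (d%:R * (Mg * (MR * rho + Mx))) : 'rV[R]_d -> R.
have G0 y : 0 <= G y.
  by rewrite /G /= mulr_ge0// mulr_ge0// addr_ge0// mulr_ge0// ltW.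
have intF (s : R) : `]0, 1[%classic s -> m.-integrable B (EFin \o F s).
  move=> _; apply: (integrableS measurableT mB) => //.
  apply: (integrable_on_ball hm (M := Mphi)); last by move=> x _; exact: hMphi.
  exact: measurable_comp_affine.
have derF (s : R) x : `]0, 1[%classic s -> B x -> derivable (F^~ x) s 1.
  by rewrite /= in_itv/= => s01 _; have [] := dF s x s01.
have intG : m.-integrable B (EFin \o G).
  apply: (integrableS measurableT mB) => //.
  apply: (integrable_on_ball hm (M := G 0)) => // x _.
  by rewrite ger0_norm.
have G_ub (s : R) x : `]0, 1[%classic s -> B x -> `|partial1of2 F s x| <= G x.
  rewrite /= in_itv/= => s01 Bx; rewrite partial1of2E.
  have s01' : 0 <= s <= 1 by lra.
  have [_ ->] := dF s x s01.
  apply: le_trans (ler_norm_sum _ _ _) _.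
  rewrite /G/= -[X in X%:R * _]card_ord -sum1_card natr_sum mulr_suml.
  apply: ler_sum => i _; rewrite mul1r normrM; apply: ler_pM => //.
  rewrite !mxE; apply: le_trans (ler_normD _ _) _; apply: lerD; last first.
    by apply: le_trans (ler_coord_norm _ _) _; exact: hMx.
  by rewrite normrM; apply: ler_pM => //; [exact: hMR|exact: ball_coord].
have mF s : measurable_fun setT (F s) by exact: measurable_comp_affine.
have FE : (fun s => \int[m]_x F s x) = (fun s => \int[m]_(x in B) F s x).
  by apply/funext => s; rewrite Rintegral_ball.
rewrite [X in is_derive _ _ X](_ : _ = (fun s => \int[m]_(x in B) F s x))//.
apply: DeriveDef; first exact: (derivable_under_integral mB It intF derF G0 intG G_ub).
rewrite -derive1E (differentiation_under_integral mB It intF derF G0 intG G_ub).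
rewrite -[RHS]Rintegral_ball; last first.
  have mT : measurable_fun setT (affine (Rs t) (xbar t)) by exact: measurable_affine.
  apply: measurable_fun_dot; last exact: measurable_affine.
  exact: (measurableT_comp (measurable_gradient phiC) mT).
by apply: eq_Rintegral => x _; rewrite partial1of2E; have [_ ->] := dF t x t01.
Qed.

End differentiate_curve.

Section tangent.
Context {R : realType} {d : nat} (Omega : set 'rV[R]_d).
Hypothesis mO : measurable Omega.
Context {A rho : R}.
Hypothesis hrho : 0 < rho.
Variable m : probability 'rV[R]_d R.
Hypothesis hm : has_density m (profile A rho).
Variables (Rs : R -> R) (xbar : R -> 'rV[R]_d).
Hypotheses (RsC2 : C2_01 Rs) (xbarC2 : C2_01 xbar).
Hypothesis Rs_gt0 : forall t, 0 <= t <= 1 -> 0 < Rs t.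
Hypothesis supp : forall t, 0 <= t <= 1 -> ssim_curve m Rs xbar t (~` Omega) = 0%E.

Let mu := ssim_curve m Rs xbar.
Let u := ssim_density A rho Rs xbar.
Let v := ssim_velocity Rs xbar.

Lemma Rintegral_dot_velocity (w : 'rV[R]_d -> 'rV[R]_d) t : 0 <= t <= 1 ->
  measurable_fun setT w ->
  \int[mu t]_(x in Omega) dot (w x) (v t x) =
  \int[m]_x dot (w (affine (Rs t) (xbar t) x))
    (derive01 Rs t *: x + derive01 xbar t).
Proof.
move=> t01 mw; have Rt0 := Rs_gt0 t01; have st := supp t01.
rewrite (Rintegral_ssim_curve mO st); last first.
  exact: measurable_fun_dot mw (measurable_ssim_velocity Rs xbar t).
by apply: eq_Rintegral => x _; rewrite /v (ssim_velocity_affine xbar Rt0).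
Qed.

Lemma is_derive_curve_integral phi (t : R) : C1c phi -> 0 < t < 1 ->
  is_derive t 1 (fun s => \int[mu s]_(x in Omega) phi x)
    (\int[mu t]_(x in Omega) dot (gradient phi x) (v t x)).
Proof.
move=> phiC t01; have t01' : 0 <= t <= 1 by lra.
rewrite Rintegral_dot_velocity//; last exact: measurable_gradient.
apply: near_eq_is_derive (is_derive_Rintegral_curve hrho hm RsC2 xbarC2 phiC t01).
apply: filterS (near_in01 t01) => s s01.
rewrite (Rintegral_ssim_curve mO (supp s01))//.
exact: (continuous_measurable_rV (C1c_continuous phiC)).
Qed.

Lemma integral_sqnorm_velocity t : 0 <= t <= 1 ->
  (\int[mu t]_(x in Omega) (sqnorm (v t x))%:E =
   \int[m]_x (sqnorm (derive01 Rs t *: x + derive01 xbar t))%:E)%E.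
Proof.
move=> t01; have Rt0 := Rs_gt0 t01.
have mv := measurable_fun_sqnorm (measurable_ssim_velocity Rs xbar t).
rewrite (integral_affine_push mO mv (supp t01)).
by apply: eq_integral => x _; rewrite /v (ssim_velocity_affine xbar Rt0).
Qed.

Lemma ssim_velocity_field : velocity_field Omega mu v.
Proof.
apply: aeW => t t01; have t01' : 0 <= t <= 1 by lra.
split.
- exact: measurable_funTS (measurable_ssim_velocity Rs xbar t).
- rewrite integral_sqnorm_velocity//; apply: integrable_lty => //.
  exact: (integrable_sqnorm_affine hrho hm).
- by move=> phi phiC; exact: is_derive_curve_integral.
Qed.

Lemma ssim_continuity_equation : continuity_equation Omega u v.
Proof.
apply: aeW => t t01 phi phiC; have t01' : 0 <= t <= 1 by lra.
have mphi : measurable_fun setT phi.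
  exact: (continuous_measurable_rV (C1c_continuous phiC)).
rewrite (Rintegral_ssim_density mO hm xbar (Rs_gt0 t01'))//; last first.
  exact: measurable_fun_dot (measurable_gradient phiC)
    (measurable_ssim_velocity Rs xbar t).
apply: near_eq_is_derive (is_derive_curve_integral phiC t01).
apply: filterS (near_in01 t01) => s s01.
by rewrite (Rintegral_ssim_density mO hm xbar (Rs_gt0 s01)).
Qed.

(** On the support of [mu_t] the velocity is the gradient [g] of a test
    function.  Both fields solve the continuity equation, so they have the same
    integral against [g], and the bound follows by integrating
    [2 g . w - |g|^2 <= |w|^2]. *)
Lemma ssim_velocity_minimal t (w : 'rV[R]_d -> 'rV[R]_d) : 0 < t < 1 ->
  measurable_fun Omega w ->
  (\int[mu t]_(x in Omega) (sqnorm (w x))%:E < +oo)%E ->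
  (forall phi, C1c phi ->
    is_derive t 1 (fun s => \int[mu s]_(x in Omega) phi x)
      (\int[mu t]_(x in Omega) dot (gradient phi x) (w x))) ->
  (\int[mu t]_(x in Omega) (sqnorm (v t x))%:E <=
   \int[mu t]_(x in Omega) (sqnorm (w x))%:E)%E.
Proof.
move=> t01 mw wfin dw; have t01' : 0 <= t <= 1 by lra.
have Rt0 := Rs_gt0 t01'.
(* the squared radius of the support, so that nothing is cut off there *)
pose L := (Rs t * rho) ^+ 2.
have L0 : 0 < L by rewrite exprn_gt0// mulr_gt0.
pose phi := potential (derive01 Rs t / Rs t) L (derive01 xbar t) (xbar t).
have phiC : C1c phi by exact: C1c_potential.
pose g := gradient phi.
have mg : measurable_fun setT g by exact: measurable_gradient.
have mv := measurable_ssim_velocity Rs xbar t.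
have gv x : sqnorm x < rho ^+ 2 ->
    g (affine (Rs t) (xbar t) x) = v t (affine (Rs t) (xbar t) x).
  move=> xB; rewrite /g /phi gradient_potential//.
  rewrite /affine addrK sqnormZ /L exprMn ler_pM2l ?exprn_gt0//; exact: ltW.
have intw : (mu t).-integrable Omega (EFin \o (fun x => sqnorm (w x))).
  apply/integrableP; split; first exact/measurable_EFinP/measurable_fun_sqnorm.
  by under eq_integral do rewrite /= ger0_norm ?sqnorm_ge0//.
have toball (f h : 'rV[R]_d -> R) : measurable_fun setT f -> measurable_fun setT h ->
    (forall x, sqnorm x < rho ^+ 2 ->
      f (affine (Rs t) (xbar t) x) = h (affine (Rs t) (xbar t) x)) ->
    (\int[mu t]_(x in Omega) (f x)%:E = \int[mu t]_(x in Omega) (h x)%:E)%E.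
  move=> mf mh fh; rewrite !(integral_affine_push mO _ (supp t01'))//.
  by apply: (eq_integral_ball hm) => //; exact: measurable_comp_affine.
have gg : (\int[mu t]_(x in Omega) (sqnorm (g x))%:E =
    \int[mu t]_(x in Omega) (sqnorm (v t x))%:E)%E.
  apply: toball => [||x /gv ->//]; exact: measurable_fun_sqnorm.
have gvv : (\int[mu t]_(x in Omega) (dot (g x) (v t x))%:E =
    \int[mu t]_(x in Omega) (sqnorm (v t x))%:E)%E.
  apply: toball => [||x /gv ->//]; first exact: measurable_fun_dot.
  exact: measurable_fun_sqnorm.
have gw : \int[mu t]_(x in Omega) dot (g x) (w x) =
    \int[mu t]_(x in Omega) dot (g x) (v t x).
  have [_ <-] := dw phi phiC; have [_ <-] := is_derive_curve_integral phiC t01.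
  by [].
have vfin : (\int[mu t]_(x in Omega) (sqnorm (v t x))%:E < +oo)%E.
  rewrite integral_sqnorm_velocity//; apply: integrable_lty => //.
  exact: (integrable_sqnorm_affine hrho hm).
have intg : (mu t).-integrable Omega (EFin \o (fun x => sqnorm (g x))).
  apply/integrableP; split.
    exact/measurable_EFinP/measurable_funTS/measurable_fun_sqnorm.
  by under eq_integral do rewrite /= ger0_norm ?sqnorm_ge0//; rewrite gg.
have intgw : (mu t).-integrable Omega (EFin \o (fun x => dot (g x) (w x))).
  apply: (@le_integrable _ _ _ _ _ mO _
    (EFin \o (fun x => sqnorm (g x) + sqnorm (w x)))).
  - by apply/measurable_EFinP/measurable_fun_dot => //; exact: measurable_funTS.
  - move=> x _; rewrite /= lee_fin [leRHS]ger0_norm; last first.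
      by rewrite addr_ge0 ?sqnorm_ge0.
    have h1 := sqnorm_ge0 (g x + w x); have h2 := sqnorm_ge0 (g x + (-1) *: w x).
    move: h1 h2; rewrite !sqnormD sqnormZ dotZr => h1 h2.
    have := sqnorm_ge0 (g x); have := sqnorm_ge0 (w x).
    rewrite ler_norml => ? ?; apply/andP; split; lra.
  - rewrite /comp; under eq_fun do rewrite EFinD; exact: integrableD.
set E := \int[mu t]_(x in Omega) sqnorm (v t x).
have EE : (\int[mu t]_(x in Omega) (sqnorm (v t x))%:E = E%:E)%E.
  by rewrite /E /Rintegral fineK// ge0_fin_numE// integral_ge0// => x _;
    rewrite lee_fin sqnorm_ge0.
have WW : (\int[mu t]_(x in Omega) (sqnorm (w x))%:E =
    (\int[mu t]_(x in Omega) sqnorm (w x))%:E)%E.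
  by rewrite /Rintegral fineK// ge0_fin_numE// integral_ge0// => x _;
    rewrite lee_fin sqnorm_ge0.
rewrite EE WW lee_fin.
have int2 : (mu t).-integrable Omega (EFin \o (fun x => 2 * dot (g x) (w x))).
  by rewrite /comp; under eq_fun do rewrite EFinM; exact: integrableZl.
(* by [gw] this is the value of the same integral for [w = v = g] *)
have -> : E = \int[mu t]_(x in Omega) (2 * dot (g x) (w x) - sqnorm (g x)).
  rewrite RintegralB// RintegralZl// gw.
  by rewrite /Rintegral gvv gg -/E; rewrite EE /=; ring.
apply: le_Rintegral => //.
  by rewrite /comp; under eq_fun do rewrite EFinB; exact: integrableB.
move=> x _; have := sqnorm_ge0 (g x + (-1) *: w x).
by rewrite sqnormD sqnormZ dotZr; lra.
Qed.

Lemma ssim_tangent_field : tangent_field Omega mu v.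
Proof.
split; first exact: ssim_velocity_field.
move=> w vw; have := ae_filter_ringOfSetsType (@lebesgue_measure R) => FF.
apply: filterS vw => t wt t01; have [mw wfin dw] := wt t01.
exact: ssim_velocity_minimal.
Qed.

End tangent.

(** * Weak continuity up to the endpoints *)

Section weak_limit.
Context {R : realType} {d : nat} (Omega : set 'rV[R]_d).
Hypothesis mO : measurable Omega.
Context {A rho : R}.
Variable m : probability 'rV[R]_d R.
Hypothesis hm : has_density m (profile A rho).
Variables (Rs : R -> R) (xbar : R -> 'rV[R]_d).
Hypotheses (RsC2 : C2_01 Rs) (xbarC2 : C2_01 xbar).
Hypothesis Rs_gt0 : forall t, 0 <= t <= 1 -> 0 < Rs t.
Hypothesis supp : forall t, 0 <= t <= 1 -> ssim_curve m Rs xbar t (~` Omega) = 0%E.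

Let mu := ssim_curve m Rs xbar.
Let u := ssim_density A rho Rs xbar.

Lemma curve_integral_continuous f a : continuous f ->
  (exists M, forall x, `|f x| <= M) -> -1 < a < 2 ->
  {for a, continuous (fun t => \int[m]_x
    f (affine (Rs (clamp01 t)) (xbar (clamp01 t)) x))}.
Proof.
move=> cf [M fM] a12; have [dR _ _] := RsC2; have [dx _ _] := xbarC2.
have mf : measurable_fun setT f by exact: continuous_measurable_rV.
apply: (@continuity_under_integral _ _ _ m
  (fun t x => f (affine (Rs (clamp01 t)) (xbar (clamp01 t)) x)) setT measurableT
  (-1) 2 _ _ (cst M)).
- move=> t _; apply: (integrable_on_ball hm (M := M)) => //.
  exact: measurable_comp_affine.
- apply: aeW => x _ t _.
  apply: (@continuous_comp _ _ _
    (fun t => affine (Rs (clamp01 t)) (xbar (clamp01 t)) x) f); last exact: cf.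
  apply: cvgD; last exact: clamp01_continuous.
  by apply: cvgZr_tmp; exact: clamp01_continuous.
- by apply: (integrable_on_ball hm (M := `|M|)).
- by move=> t _; apply: aeW => x _; exact: fM.
- by rewrite inE /= in_itv.
Qed.

(** Stated for a filter so as to cover the right limit at 0 and the left limit
    at 1 together. *)
Lemma ssim_weak_limit (t0 : R) (G : set_system R) : Filter G -> 0 <= t0 <= 1 ->
  G --> t0 -> (\forall t \near G, 0 <= t <= 1) -> weak_limit Omega u G (mu t0).
Proof.
move=> FG t01 Gt0 G01 f cf fM.
have mf : measurable_fun setT f by exact: continuous_measurable_rV.
rewrite (Rintegral_ssim_curve mO (supp t01))//.
(* [[-1, 2]] stands for any open neighbourhood of the unit interval *)
have a12 : -1 < t0 < 2 by lra.
pose F t := \int[m]_x f (affine (Rs (clamp01 t)) (xbar (clamp01 t)) x).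
have cF : {for t0, continuous F} by exact: curve_integral_continuous.
rewrite -[X in affine (Rs X)](clamp01_id t01) -[X in affine _ (xbar X)](clamp01_id t01) -/(F t0).
apply: cvg_trans (cvg_comp _ _ Gt0 cF); apply: near_eq_cvg.
apply: filterS G01 => t t01' /=; rewrite /F.
rewrite (Rintegral_ssim_density mO hm xbar (Rs_gt0 t01'))//.
by rewrite (Rintegral_ssim_curve mO (supp t01'))// clamp01_id.
Qed.

End weak_limit.

(** * The momentum equation *)

Section momentum.
Context {R : realType} {d : nat}.
Context {A rho : R}.
Hypothesis hA : 0 < A.
Variables (Rs : R -> R) (xbar : R -> 'rV[R]_d).
Hypotheses (RsC2 : C2_01 Rs) (xbarC2 : C2_01 xbar).
Hypothesis Rs_gt0 : forall t, 0 <= t <= 1 -> 0 < Rs t.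

Let u := ssim_density A rho Rs xbar.
Let v := ssim_velocity Rs xbar.

Lemma ssim_density_gt0 t x : 0 < Rs t ->
  (0 < u t x) = (sqnorm (x - xbar t) < (Rs t * rho) ^+ 2).
Proof.
move=> Rt0; rewrite /u /ssim_density /profile sqnormZ.
rewrite pmulr_rgt0 ?invr_gt0 ?exprn_gt0// pmulr_rgt0// lt_max ltxx orbF subr_gt0.
by rewrite exprVn mulrC ltr_pdivrMr ?exprn_gt0// exprMn mulrC.
Qed.

Lemma ssim_density_gradient t x : 0 < Rs t -> 0 < u t x ->
  differentiable (u t) x /\
  gradient (u t) x = (- (2 * A * (Rs t) ^- d.+2)) *: (x - xbar t).
Proof.
move=> Rt0; rewrite ssim_density_gt0// => xB.
pose z y : R := rho ^+ 2 - (Rs t) ^- 2 * sqnorm (y - xbar t).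
have uE : u t = ((Rs t) ^- d * A) \*: ((fun s => Num.max s 0) \o z).
  apply/funext => y; rewrite /u /ssim_density /profile sqnormZ exprVn mulrA.
  by [].
have dz y : differentiable z y.
  apply: (@differentiableB _ _ _ (cst (rho ^+ 2))
    ((Rs t) ^- 2 \*: (fun y => sqnorm (y - xbar t)))).
    exact: differentiable_cst.
  exact/differentiableZ/differentiable_sqnormB.
have Dz h : 'D_h z x = - ((Rs t) ^- 2 * (2 * dot (x - xbar t) h)).
  have [_ H] := @is_deriveB _ _ _ (cst (rho ^+ 2))
    ((Rs t) ^- 2 \*: (fun y => sqnorm (y - xbar t))) x h _ _
    (is_derive_cst _ _ _) (is_deriveZ _ (is_derive_sqnormB (xbar t) x h)).
  by rewrite [LHS]H sub0r.
have zx : 0 < z x.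
  rewrite subr_gt0 mulrC ltr_pdivrMr ?exprn_gt0//.
  by move: xB; rewrite exprMn mulrC.
have dmax := is_derive_max0 zx.
split.
  rewrite uE; apply: differentiableZ; apply: differentiable_comp => //.
  by apply/derivable1_diffP; have [] := dmax.
apply/rowP => i; rewrite mxE uE.
have [_ ->] := is_deriveZ ((Rs t) ^- d * A)
  (is_derive_comp_scalar (delta_mx 0 i) (dz x) dmax).
rewrite Dz mul1r dot_delta [RHS]mxE.
rewrite -[LHS]/((Rs t) ^- d * A *
  - ((Rs t) ^- 2 * (2 * (x - xbar t) 0 i))).
have -> : (Rs t) ^- d.+2 = (Rs t) ^- d * (Rs t) ^- 2 by rewrite -addn2 exprD invfM.
by ring.
Qed.

Lemma ssim_velocity_coord s x i : v s x 0 i =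
  derive01 Rs s / Rs s * (x 0 i - xbar s 0 i) + derive01 xbar s 0 i.
Proof. by rewrite /v /ssim_velocity !mxE. Qed.

Lemma ssim_velocity_differentiable t x : differentiable (v t) x.
Proof.
apply: (@differentiableD _ _ _ (fun y => derive01 Rs t / Rs t *: (y - xbar t))
  (cst (derive01 xbar t))); last exact: differentiable_cst.
apply: (@differentiableZ _ _ _ (fun y => y - xbar t)).
apply: (@differentiableB _ _ _ id (cst (xbar t))) => //.
Qed.

Lemma ssim_velocity_space_derive t x h i :
  'D_h (fun y => v t y 0 i) x = derive01 Rs t / Rs t * h 0 i.
Proof.
have -> : (fun y => v t y 0 i) = (derive01 Rs t / Rs t) \*: (fun y => dot y (delta_mx 0 i))
    + cst (derive01 xbar t 0 i - derive01 Rs t / Rs t * xbar t 0 i).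
  apply/funext => y; rewrite ssim_velocity_coord.
  rewrite -[RHS]/(derive01 Rs t / Rs t * dot y (delta_mx 0 i) +
    (derive01 xbar t 0 i - derive01 Rs t / Rs t * xbar t 0 i)) dot_delta.
  by ring.
have [_ ->] := is_deriveD (is_deriveZ (derive01 Rs t / Rs t)
  (is_derive_dot (delta_mx 0 i) x h))
  (is_derive_cst (derive01 xbar t 0 i - derive01 Rs t / Rs t * xbar t 0 i) x h).
by rewrite addr0 dot_delta.
Qed.

Lemma convectionE t x :
  convection (v t) x = (derive01 Rs t / Rs t) *: v t x.
Proof.
apply/rowP => i; rewrite [LHS]mxE [RHS]mxE (bigD1 i)//= big1 ?addr0; last first.
  move=> j ji; rewrite ssim_velocity_space_derive [delta_mx _ _ _ _]mxE eqxx eq_sym (negbTE ji).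
  by rewrite !mulr0.
by rewrite ssim_velocity_space_derive [delta_mx _ _ _ _]mxE !eqxx mulr1 mulrC.
Qed.

(** The terms in [Rs'] cancel between the convection and the time derivative:
    each particle moves along [Rs t *: x + xbar t], whose acceleration is
    [Rs'' x + xbar'']. *)
Lemma ssim_velocity_time_derive t x : 0 < t < 1 ->
  derivable (fun s => v s x) t 1 /\
  convection (v t) x + 'D_1 (fun s => v s x) t =
  (derive01 (derive01 Rs) t / Rs t) *: (x - xbar t) + derive01 (derive01 xbar) t.
Proof.
move=> t01; have t01' : 0 <= t <= 1 by lra.
have [dR ddR _] := RsC2; have [dx ddx _] := xbarC2.
have Rt0 : Rs t != 0 by rewrite gt_eqF// Rs_gt0.
have DR := is_derive_derive01 t01 (dR _ t01').
have DDR := is_derive_derive01 t01 (ddR _ t01').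
have DV : is_derive t 1 (fun s => (Rs s)^-1) (- (Rs t) ^- 2 * derive01 Rs t).
  have [DR1 DR2] := DR; apply: DeriveDef; first exact: derivableV.
  by rewrite deriveV// DR2.
have Dc i : is_derive t 1 (fun s => v s x 0 i)
    ((derive01 (derive01 Rs) t / Rs t - (derive01 Rs t / Rs t) ^+ 2) *
      (x 0 i - xbar t 0 i) - derive01 Rs t / Rs t * derive01 xbar t 0 i +
      derive01 (derive01 xbar) t 0 i).
  have [dxi dxiE] := derivable01_coord i t01' (dx _ t01').
  have [ddxi ddxiE] := derivable01_coord i t01' (ddx _ t01').
  have Dx := is_derive_derive01 t01 dxi; rewrite dxiE in Dx.
  have DDx := is_derive_derive01 t01 ddxi; rewrite ddxiE in DDx.
  have -> : (fun s => v s x 0 i) = (derive01 Rs * (fun s => (Rs s)^-1)) *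
      (cst (x 0 i) - (fun s => xbar s 0 i)) + (fun s => derive01 xbar s 0 i).
    by apply/funext => s; rewrite ssim_velocity_coord.
  apply: is_derive_eq (is_deriveD (is_deriveM (is_deriveM DDR DV)
    (is_deriveB (is_derive_cst (x 0 i) t 1) Dx)) DDx) _.
  rewrite -[LHS]/(derive01 Rs t * (Rs t)^-1 * (0 - derive01 xbar t 0 i) +
    (x 0 i - xbar t 0 i) * (derive01 Rs t * (- (Rs t) ^- 2 * derive01 Rs t) +
       (Rs t)^-1 * derive01 (derive01 Rs) t) + derive01 (derive01 xbar) t 0 i).
  by field.
have dv : derivable (fun s => v s x) t 1.
  by apply/derivable_mxP => i j; rewrite ord1; have [] := Dc j.
split=> //; apply/rowP => i; rewrite convectionE derive_mx// !mxE.
have [_ ->] := Dc i; by field.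
Qed.

End momentum.

Section momentum_characterization.
Context {R : realType} {d : nat} (Omega : set 'rV[R]_d).
Hypothesis hd : (0 < d)%N.
Hypothesis mO : measurable Omega.
Context {A rho : R}.
Hypotheses (hA : 0 < A) (hrho : 0 < rho).
Variable m : probability 'rV[R]_d R.
Hypothesis hm : has_density m (profile A rho).
Variables (Rs : R -> R) (xbar : R -> 'rV[R]_d).
Hypotheses (RsC2 : C2_01 Rs) (xbarC2 : C2_01 xbar).
Hypothesis Rs_gt0 : forall t, 0 <= t <= 1 -> 0 < Rs t.
Hypothesis supp : forall t, 0 <= t <= 1 -> ssim_curve m Rs xbar t (~` Omega) = 0%E.

Let u := ssim_density A rho Rs xbar.
Let v := ssim_velocity Rs xbar.
Variable K : R.
Hypothesis hV : forall t, 0 <= t <= 1 -> 0 < Vfun Omega u v t.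
Hypothesis hK : forall t, 0 <= t <= 1 ->
  Ffun Omega u t / Num.sqrt (Vfun Omega u v t) = K.

Let F0 : R := 4 * A * rho ^+ 2 / (d + 4)%:R.
Let M2 : R := d%:R * rho ^+ 2 / (d + 4)%:R.

Let F0_gt0 : 0 < F0.
Proof. by rewrite divr_gt0 ?ltr0n ?addn_gt0 ?orbT// !mulr_gt0// exprn_gt0. Qed.

Let M2_gt0 : 0 < M2.
Proof. by rewrite divr_gt0 ?ltr0n ?addn_gt0 ?orbT// mulr_gt0 ?ltr0n// exprn_gt0. Qed.

Let FE t : 0 <= t <= 1 -> Ffun Omega u t = (Rs t) ^- d * F0.
Proof.
by move=> t01; rewrite (FfunE mO hA hm (Rs_gt0 t01) (supp t01)) (profile_energy hA hm).
Qed.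

Let VE t : 0 <= t <= 1 ->
  Vfun Omega u v t = M2 * derive01 Rs t ^+ 2 + sqnorm (derive01 xbar t).
Proof.
move=> t01; rewrite (VfunE mO hrho hm (Rs_gt0 t01) (supp t01)).
by rewrite (second_momentE hA hm) mulrC.
Qed.

Let K_gt0 : 0 < K.
Proof.
have t01 : 0 <= (0:R) <= 1 by rewrite lexx ler01.
rewrite -(hK t01) divr_gt0 ?sqrtr_gt0 ?hV// FE//.
by rewrite mulr_gt0// invr_gt0 exprn_gt0// Rs_gt0.
Qed.

Let sqrtVE t : 0 <= t <= 1 -> Num.sqrt (Vfun Omega u v t) = (Rs t) ^- d * F0 / K.
Proof.
move=> t01; rewrite -FE// -(hK t01) invf_div mulrCA divff ?mulr1// FE//.
by rewrite mulf_neq0 ?invr_neq0 ?expf_neq0 ?gt_eqF// Rs_gt0.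
Qed.

(** This is [F / sqrt V = K], squared. *)
Lemma ssim_conserved_energy t : 0 <= t <= 1 ->
  Rs t ^+ (2 * d) * (M2 * derive01 Rs t ^+ 2 + sqnorm (derive01 xbar t)) =
  F0 ^+ 2 / K ^+ 2.
Proof.
move=> t01; rewrite -VE// -(sqr_sqrtr (ltW (hV t01))) sqrtVE//.
have Rd0 : Rs t ^+ d != 0 by rewrite expf_neq0// gt_eqF// Rs_gt0.
have K0 : K != 0 by rewrite gt_eqF.
by rewrite mulnC exprM; field; rewrite Rd0 K0.
Qed.

(** On the ball the equation is affine in [x - xbar t]: its value at the centre
    gives the condition on [xbar], and its value at one other point, which
    exists in positive dimension, gives the condition on [Rs]. *)
Lemma ssim_momentumP : momentum_equation Omega K u v <->
  forall t, 0 < t < 1 -> derive01 (derive01 xbar) t = 0 /\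
    K ^+ 2 * derive01 (derive01 Rs) t * Rs t ^+ (2 * d).+1 = - (4 * A * F0).
Proof.
have key (t : R) x : 0 < t < 1 -> 0 < u t x ->
    - (2 * Num.sqrt (Vfun Omega u v t)) *: gradient (u t) x
          + K *: (convection (v t) x + 'D_1 (fun s => v s x) t) =
    ((K ^+ 2 * derive01 (derive01 Rs) t * Rs t ^+ (2 * d).+1 + 4 * A * F0) /
       (K * Rs t ^+ (2 * d).+2)) *: (x - xbar t) + K *: derive01 (derive01 xbar) t.
  move=> t01 ux; have t01' : 0 <= t <= 1 by lra.
  have Rt0 := Rs_gt0 t01'.
  have [_ ->] := ssim_density_gradient hA Rt0 ux.
  have [_ ->] := ssim_velocity_time_derive RsC2 xbarC2 Rs_gt0 x t01.
  rewrite [K *: (_ + derive01 _ _)]scalerDr addrA !scalerA -scalerDl; congr (_ *: _ + _).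
  rewrite sqrtVE// (_ : (2 * d).+2 = d + d.+2)%N; last by rewrite mul2n -addnn !addnS.
  rewrite (_ : (2 * d).+1 = d + d.+1)%N; last by rewrite mul2n -addnn !addnS.
  rewrite !exprD !exprS.
  have K0 : K != 0 by rewrite gt_eqF.
  have R0 : Rs t != 0 by rewrite gt_eqF.
  have Rd0 : Rs t ^+ d != 0 by rewrite expf_neq0.
  by field; rewrite K0 R0 Rd0.
have Kn0 : K != 0 by rewrite gt_eqF.
split=> [mom t t01|eqs t x t01 ux].
  have t01' : 0 <= t <= 1 by lra.
  have Rt0 := Rs_gt0 t01'.
  have u0 : 0 < u t (xbar t).
    rewrite ssim_density_gt0// subrr -(scale0r (0 : 'rV[R]_d)) sqnormZ expr0n mul0r.
    by rewrite exprn_gt0// mulr_gt0.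
  have [_ _ _] := mom _ _ t01 u0; rewrite key// subrr scaler0 add0r.
  move=> /eqP; rewrite scaler_eq0 (negbTE Kn0)/= => /eqP c0; split=> //.
  pose e : 'rV[R]_d := delta_mx 0 (Ordinal hd).
  (* half the radius: [xbar t + l *: e] is a point of the ball other than its centre *)
  pose l := Rs t * rho / 2.
  have l0 : 0 < l by rewrite divr_gt0// mulr_gt0.
  have u1 : 0 < u t (xbar t + l *: e).
    rewrite ssim_density_gt0// addrC addKr sqnormZ.
    rewrite [sqnorm e]dot_delta mxE !eqxx mulr1.
    have := mulr_gt0 Rt0 hrho; rewrite /l => h; nra.
  have [_ _ _] := mom _ _ t01 u1; rewrite key// c0 scaler0 addr0.
  rewrite [X in _ *: X](_ : _ = l *: e); last by rewrite addrC addKr.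
  move=> /rowP/(_ (Ordinal hd)); rewrite !mxE !eqxx mulr1 => /eqP.
  rewrite mulf_eq0 (gt_eqF l0) orbF mulf_eq0 invr_eq0 mulf_eq0 (negbTE Kn0).
  by rewrite expf_eq0 (gt_eqF Rt0) andbF !orbF addr_eq0 => /eqP.
have t01' : 0 <= t <= 1 by lra.
have Rt0 := Rs_gt0 t01'.
have [c0 R2] := eqs t t01.
split.
- by have [] := ssim_density_gradient hA Rt0 ux.
- exact: ssim_velocity_differentiable.
- by have [] := ssim_velocity_time_derive RsC2 xbarC2 Rs_gt0 x t01.
- by rewrite key// c0 R2 addNr mul0r scale0r scaler0 addr0.
Qed.

Lemma ssim_momentum_iff : momentum_equation Omega K u v <->
  (forall t, 0 <= t <= 1 -> xbar t = (1 - t) *: xbar 0 + t *: xbar 1) /\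
  strictly_concave01 Rs.
Proof.
have Kn0 : K != 0 by rewrite gt_eqF.
rewrite ssim_momentumP; split=> [eqs|[seg conc] t t01].
  split; first by apply: C2_01_affineP => // t /eqs[].
  have [dR ddR _] := RsC2; apply: strictly_concave01_derive => // t t01.
  have t01' : 0 <= t <= 1 by lra.
  have [_ h] := eqs t t01.
  have p0 : 0 < K ^+ 2 * Rs t ^+ (2 * d).+1 by rewrite mulr_gt0// exprn_gt0// Rs_gt0.
  rewrite -(pmulr_rlt0 _ p0) mulrAC h oppr_lt0.
  by rewrite mulr_gt0// mulr_gt0.
have t01' : 0 <= t <= 1 by lra.
split; first by have [] := derive01_segment seg t01'.
have energy s : 0 <= s <= 1 -> Rs s ^+ (2 * d) *
    (M2 * derive01 Rs s ^+ 2 + sqnorm (xbar 1 - xbar 0)) = F0 ^+ 2 / K ^+ 2.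
  move=> s01; rewrite -(ssim_conserved_energy s01).
  by have [-> _] := derive01_segment seg s01.
have := acceleration_of_conserved_energy RsC2 energy conc t01.
move=> h; apply: (mulfI (lt0r_neq0 M2_gt0)).
have -> : M2 * (K ^+ 2 * derive01 (derive01 Rs) t * Rs t ^+ (2 * d).+1) =
  K ^+ 2 * (M2 * derive01 (derive01 Rs) t * Rs t ^+ (2 * d).+1) by ring.
rewrite h mulrN mulrCA [F0 ^+ 2 / _]mulrC mulVKf ?expf_neq0// mulrN; congr (- _).
rewrite /M2 /F0; have d4 : (d + 4)%:R != 0 :> R by rewrite pnatr_eq0 addnC.
by field.
Qed.

End momentum_characterization.

(** * The characterization of moving self-similar solutions *)

Theorem theorem3p5 (R : realType) (d : nat) (hd : (0 < d)%N)
    (Omega : set 'rV[R]_d) (hOc : closed Omega)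
    (hOconv : convex_set (Omega : set (convex_lmodType 'rV[R]_d)))
    (hO0 : Omega 0)
    (A rho : R) (hA : 0 < A) (hrho : 0 < rho)
    (mubar : probability 'rV[R]_d R) (hmubarO : mubar (~` Omega) = 0%E)
    (hmubar : has_density mubar (profile A rho))
    (x0 x1 : 'rV[R]_d) (hx0 : Omega x0) (hx1 : Omega x1)
    (Rs : R -> R) (hRs2 : C2_01 Rs)
    (hRs_gt0 : forall t, 0 <= t <= 1 -> 0 < Rs t)
    (xbar : R -> 'rV[R]_d) (hxbar2 : C2_01 xbar)
    (hxbar0 : xbar 0 = x0) (hxbar1 : xbar 1 = x1)
    (hsupp : forall t, 0 <= t <= 1 ->
      ssim_curve mubar Rs xbar t (~` Omega) = 0%E)
    (K : R)
    (hV : forall t, 0 <= t <= 1 ->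
      0 < Vfun Omega (ssim_density A rho Rs xbar) (ssim_velocity Rs xbar) t)
    (hK : forall t, 0 <= t <= 1 ->
      Ffun Omega (ssim_density A rho Rs xbar) t /
      Num.sqrt
        (Vfun Omega (ssim_density A rho Rs xbar) (ssim_velocity Rs xbar) t) = K) :
  let mu := ssim_curve mubar Rs xbar in
  let u := ssim_density A rho Rs xbar in
  let v := ssim_velocity Rs xbar in
  let r := fun t => rho * Rs t in
  [/\ forall t, 0 <= t <= 1 -> has_density (mu t) (u t),
      tangent_field Omega mu v,
      solves_system Omega K mu u v <->
        (forall t, 0 <= t <= 1 -> xbar t = (1 - t) *: x0 + t *: x1) /\
        strictly_concave01 Rs
    & solves_system Omega K mu u v <->
        [/\ forall t, 0 <= t <= 1 -> derive01 (derive01 xbar) t = 0,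
            exists c : R, forall t, 0 <= t <= 1 ->
              r t ^+ (2 * d) *
                (d%:R * derive01 r t ^+ 2
                 + (d + 4)%:R * sqnorm (derive01 xbar t)) = c
          & strictly_concave01 Rs]].
Proof.
move=> mu u v r.
have mO := closed_measurable_rV hOc.
have z01 : 0 <= (0:R) <= 1 by rewrite lexx ler01.
have o01 : 0 <= (1:R) <= 1 by rewrite lexx ler01.
have momP := ssim_momentum_iff hd mO hA hrho hmubar hRs2 hxbar2 hRs_gt0 hsupp hV hK.
rewrite hxbar0 hxbar1 in momP.
have solvesP : solves_system Omega K mu u v <-> momentum_equation Omega K u v.
  split=> [[]//|mom]; split=> //.
  - exact: (ssim_continuity_equation mO hrho hmubar hRs2 hxbar2 hRs_gt0 hsupp).
  - apply: (ssim_weak_limit mO hmubar hRs2 hxbar2 hRs_gt0 hsupp) => //.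
      by apply: cvg_within.
    by near=> s; apply/andP; split; near: s; [exact: nbhs_right_ge|exact: nbhs_right_le].
  - apply: (ssim_weak_limit mO hmubar hRs2 hxbar2 hRs_gt0 hsupp) => //.
      by apply: cvg_within.
    by near=> s; apply/andP; split; near: s; [exact: nbhs_left_ge|exact: nbhs_left_le].
have seg_iff : (forall t, 0 <= t <= 1 -> xbar t = (1 - t) *: x0 + t *: x1) <->
    (forall t, 0 <= t <= 1 -> derive01 (derive01 xbar) t = 0).
  split=> [seg t t01|acc]; first by have [] := derive01_segment seg t01.
  rewrite -hxbar0 -hxbar1; apply: C2_01_affineP => // t /andP[t0 t1].
  by apply: acc; rewrite !ltW.
have energy : exists c : R, forall t, 0 <= t <= 1 ->
    r t ^+ (2 * d) * (d%:R * derive01 r t ^+ 2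
      + (d + 4)%:R * sqnorm (derive01 xbar t)) = c.
  exists (rho ^+ (2 * d) * (d + 4)%:R *
    ((4 * A * rho ^+ 2 / (d + 4)%:R) ^+ 2 / K ^+ 2)) => t t01.
  rewrite -(ssim_conserved_energy mO hA hrho hmubar hRs_gt0 hsupp hV hK t01).
  have [dR _ _] := hRs2.
  rewrite /r derive01Ml//; last exact: dR.
  have d4 : (d + 4)%:R != 0 :> R by rewrite pnatr_eq0 addnC.
  by rewrite exprMn; field.
split.
- by move=> t t01; apply: ssim_has_density => //; exact: hRs_gt0.
- exact: (ssim_tangent_field mO hrho hmubar hRs2 hxbar2 hRs_gt0 hsupp).
- by rewrite solvesP.
- rewrite solvesP momP seg_iff; split=> [[acc conc]|[acc _ conc]]; by split.
Unshelve. all: by end_near. Qed.
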